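(* Let $G$ be a nilpotent group of class at most $3$ and let $e\in \mathbb{N}\cup \{0\}$ be the exponent of $\Gamma^3(G)=[[G,G],G]$ (with $e=0$ if $\Gamma^3(G)$ does not have an exponent). Suppose that for every subgroup $H\leq G$ which is nilpotent of class at most $2$ we have $[H,H]^3\leq Z(G)$. Then (i) $H_1(E(3,G);\mathbb{Z}/e)=0$ if and only if $G$ is a $2$-Engel group; (ii) $H_i(E(3,G);\mathbb{Z}/e)=0$ for $i=1,2$ if and only if $G$ is nilpotent of class at most $2$.
   Context: Commutators: $[x,y]=x^{-1}y^{-1}xy$ and $[x,y,z]=[[x,y],z]$. $Z(G)$ is the center of $G$, and for a group $K$, $K^3$ denotes the subgroup generated by the cubes of elements of $K$. A group $G$ is $2$-Engel if $[x,y,y]=1$ for all $x,y\in G$. A tuple $(x_0,\dots,x_k)\in G^{k+1}$ is called affinely nil-$2$ if there exist $y\in G$ and a subgroup $H\leq G$, nilpotent of class at most $2$, such that $x_i\in yH$ for all $i$. $E_\ast(3,G)$ is the simplicial set whose $k$-simplices are the affinely nil-$2$ tuples $(x_0,\dots,x_k)\in G^{k+1}$, with face maps $d_i$ omitting the $i$-th coordinate and degeneracy maps $s_i$ repeating the $i$-th coordinate; $E(3,G)$ is its geometric realization. By convention $\mathbb{Z}/0=\mathbb{Z}$. *)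

(* Defs.v *)
From HB Require Import structures.
From Stdlib Require Import Relation_Operators.
From mathcomp Require Import all_boot all_order all_algebra.
From mathcomp Require Import generic_quotient finmap.
From mathcomp Require Import all_classical reals topology normedtype.
From mathcomp Require Import zify.
(* The notations of [monalg] clash with those of mathcomp-analysis. *)
From mathcomp Require Import -(notations) monalg.

Set Implicit Arguments.
Unset Strict Implicit.
Unset Printing Implicit Defensive.

Import GRing.Theory Num.Theory.
Import numFieldNormedType.Exports.

Local Open Scope classical_set_scope.
Local Open Scope quotient_scope.

Section Groups.
Variable G : groupType.
Local Open Scope group_scope.
Implicit Types (H K : set G).

Definition is_subgroup H : Prop :=
  [/\ H 1, forall x y, H x -> H y -> H (x * y) & forall x, H x -> H x^-1].

Definition generated (A : set G) : set G := smallest is_subgroup A.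

Definition commutator_subgroup H K : set G :=
  generated [set z | exists x y, [/\ H x, K y & z = [~ x, y]]].

(* [lower_central n H] is the n-th term of the lower central series of H, starting at
   n = 1; the value at n = 0 is junk. *)
Fixpoint lower_central (n : nat) H : set G :=
  if n is m.+1 then
    if m is 0 then H else commutator_subgroup (lower_central m H) H
  else H.

Definition nilpotent_class_le (c : nat) H : Prop := lower_central c.+1 H = [set 1].

Definition group_center : set G := [set z | forall x, z * x = x * z].

Definition power_subgroup (n : nat) K : set G :=
  generated [set x ^+ n | x in K].

(* The exponent is the least positive n killing K, and 0 if there is none. *)
Definition has_exponent K (e : nat) : Prop :=
  let kills n := (0 < n)%N /\ forall x, K x -> x ^+ n = 1 in
  (kills e /\ forall n, kills n -> (e <= n)%N) \/
  (e = 0%N /\ forall n, ~ kills n).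

Definition two_Engel : Prop := forall x y : G, [~ [~ x, y], y] = 1.

Definition affinely_nil2 (k : nat) (x : 'I_k.+1 -> G) : Prop :=
  exists (y : G) (H : set G),
    [/\ is_subgroup H, nilpotent_class_le 2 H & forall i, H (y^-1 * x i)].

End Groups.

Arguments two_Engel : clear implicits.
Arguments group_center : clear implicits.

(* Z/e as an abelian group: Z for e = 0, and the trivial group for e = 1
   (which ['Z_1] is not). *)
Definition Zmod (e : nat) : zmodType :=
  if e is k.+1 then 'I_k.+1 : zmodType else int : zmodType.

(* The index i, resp. i + 1, in the next ordinal. *)
Definition ord_wid n (i : 'I_n) : 'I_n.+1 := widen_ord (leqnSn n) i.
Definition ord_suc n (i : 'I_n) : 'I_n.+1 := lift ord0 i.

(* The i-th codegeneracy of ordinals: the nondecreasing surjection hitting i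
   twice.  The i-th coface is [lift i]. *)
Definition codegen n (i : 'I_n.+1) (j : 'I_n.+2) : 'I_n.+1 :=
  inord (unbump i j).

Record simplicial_set := SimplicialSet {
  simplex :> nat -> choiceType;
  face : forall n, 'I_n.+2 -> simplex n.+1 -> simplex n;
  degen : forall n, 'I_n.+1 -> simplex n -> simplex n.+1;
  face_face : forall n (i j : 'I_n.+2) (x : simplex n.+2), (i <= j)%N ->
    face i (face (ord_suc j) x) = face j (face (ord_wid i) x);
  degen_degen : forall n (i j : 'I_n.+1) (x : simplex n), (i <= j)%N ->
    degen (ord_wid i) (degen j x) = degen (ord_suc j) (degen i x);
  face_degen_lt : forall n (i : 'I_n.+2) (j : 'I_n.+1) (x : simplex n.+1),
    (i <= j)%N ->
    face (ord_wid i) (degen (ord_suc j) x) = degen j (face i x);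
  face_degen_wid : forall n (i : 'I_n.+1) (x : simplex n),
    face (ord_wid i) (degen i x) = x;
  face_degen_suc : forall n (i : 'I_n.+1) (x : simplex n),
    face (ord_suc i) (degen i x) = x;
  face_degen_gt : forall n (i : 'I_n.+2) (j : 'I_n.+1) (x : simplex n.+1),
    (j < i)%N ->
    face (ord_suc i) (degen (ord_wid j) x) = degen j (face i x)
}.

Section E3.
Variable G : groupType.

Definition E3_simplex (k : nat) : choiceType :=
  set_type [set x : 'I_k.+1 -> G | affinely_nil2 x].

Lemma affinely_nil2_comp m n (x : E3_simplex n) (f : 'I_m.+1 -> 'I_n.+1) :
  set_val x \o f \in [set x : 'I_m.+1 -> G | affinely_nil2 x].
Proof.
apply/mem_set; have /= [y [H [sH nH xH]]] := set_valP x.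
by exists y, H; split=> // i; exact: xH.
Qed.

Definition E3_pull m n (f : 'I_m.+1 -> 'I_n.+1) (x : E3_simplex n) :
  E3_simplex m := SigSub (affinely_nil2_comp x f).

Definition E3_face n (i : 'I_n.+2) : E3_simplex n.+1 -> E3_simplex n :=
  E3_pull (lift i).

Definition E3_degen n (i : 'I_n.+1) : E3_simplex n -> E3_simplex n.+1 :=
  E3_pull (codegen i).

Lemma E3_pull_comp m n p (f : 'I_m.+1 -> 'I_n.+1) (g : 'I_n.+1 -> 'I_p.+1)
  (x : E3_simplex p) : E3_pull f (E3_pull g x) = E3_pull (g \o f) x.
Proof. exact: val_inj. Qed.

Lemma E3_pull_id n (f : 'I_n.+1 -> 'I_n.+1) (x : E3_simplex n) :
  f =1 id -> E3_pull f x = x.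
Proof. by move=> fE; apply: val_inj; apply/funext => i /=; rewrite fE. Qed.

Lemma codegenE n (i : 'I_n.+1) (j : 'I_n.+2) :
  codegen i j = unbump i j :> nat.
Proof. by rewrite inordK // /unbump; move: (ltn_ord i) (ltn_ord j); lia. Qed.

Lemma eq_E3_pull m n (f g : 'I_m.+1 -> 'I_n.+1) (x : E3_simplex n) :
  (forall k, f k = g k :> nat) -> E3_pull f x = E3_pull g x.
Proof.
move=> fg; suff -> : f = g by [].
by apply/funext => k; apply: ord_inj.
Qed.

Local Ltac ord_arith :=
  move=> k /=; rewrite ?codegenE /= ?codegenE /bump /unbump /=;
  have := ltn_ord k; lia.

Lemma E3_face_face n (i j : 'I_n.+2) (x : E3_simplex n.+2) : (i <= j)%N ->
  E3_face i (E3_face (ord_suc j) x) = E3_face j (E3_face (ord_wid i) x).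
Proof.
by move=> ij; rewrite /E3_face !E3_pull_comp; apply: eq_E3_pull; ord_arith.
Qed.

Lemma E3_degen_degen n (i j : 'I_n.+1) (x : E3_simplex n) : (i <= j)%N ->
  E3_degen (ord_wid i) (E3_degen j x) = E3_degen (ord_suc j) (E3_degen i x).
Proof.
by move=> ij; rewrite /E3_degen !E3_pull_comp; apply: eq_E3_pull; ord_arith.
Qed.

Lemma E3_face_degen_lt n (i : 'I_n.+2) (j : 'I_n.+1) (x : E3_simplex n.+1) :
  (i <= j)%N ->
  E3_face (ord_wid i) (E3_degen (ord_suc j) x) = E3_degen j (E3_face i x).
Proof.
move=> ij; rewrite /E3_face /E3_degen !E3_pull_comp.
by apply: eq_E3_pull; ord_arith.
Qed.

Lemma E3_face_degen_wid n (i : 'I_n.+1) (x : E3_simplex n) :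
  E3_face (ord_wid i) (E3_degen i x) = x.
Proof.
rewrite /E3_face /E3_degen E3_pull_comp.
by apply: E3_pull_id => k; apply: ord_inj; move: k; ord_arith.
Qed.

Lemma E3_face_degen_suc n (i : 'I_n.+1) (x : E3_simplex n) :
  E3_face (ord_suc i) (E3_degen i x) = x.
Proof.
rewrite /E3_face /E3_degen E3_pull_comp.
by apply: E3_pull_id => k; apply: ord_inj; move: k; ord_arith.
Qed.

Lemma E3_face_degen_gt n (i : 'I_n.+2) (j : 'I_n.+1) (x : E3_simplex n.+1) :
  (j < i)%N ->
  E3_face (ord_suc i) (E3_degen (ord_wid j) x) = E3_degen j (E3_face i x).
Proof.
move=> ij; rewrite /E3_face /E3_degen !E3_pull_comp.
by apply: eq_E3_pull; ord_arith.
Qed.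

Definition E3_sset : simplicial_set :=
  SimplicialSet E3_face_face E3_degen_degen E3_face_degen_lt
    E3_face_degen_wid E3_face_degen_suc E3_face_degen_gt.

End E3.

Section StandardSimplex.
Variable R : realType.
Local Open Scope ring_scope.

Definition std_simplex_set (n : nat) : set 'rV[R]_n.+1 :=
  [set t | (forall i, 0 <= t ord0 i) /\ \sum_i t ord0 i = 1].
Arguments std_simplex_set : clear implicits.

Definition std_simplex (n : nat) : topologicalType :=
  set_type (std_simplex_set n).

Lemma std_simplex_mapP m n (f : 'I_m.+1 -> 'I_n.+1) (t : std_simplex m) :
  (\row_j \sum_(i | f i == j) set_val t ord0 i) \in std_simplex_set n.
Proof.
apply/mem_set; have /= [t0 t1] := set_valP t; split=> [j|].
  by rewrite mxE; apply: sumr_ge0.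
rewrite -[RHS]t1 (partition_big f predT) //=.
by apply: eq_bigr => j _; rewrite mxE.
Qed.

(* The affine map determined by f on vertices. *)
Definition std_simplex_map m n (f : 'I_m.+1 -> 'I_n.+1) (t : std_simplex m) :
  std_simplex n := SigSub (std_simplex_mapP f t).

Lemma std_simplex_map_continuous m n (f : 'I_m.+1 -> 'I_n.+1) :
  continuous (std_simplex_map f).
Proof.
have coordc (j : 'I_n.+1) : continuous (fun s : std_simplex m =>
    \sum_(i | f i == j) (set_val s : 'rV[R]_m.+1) ord0 i).
  apply: (@continuous_big _ _ _ _ _ _ _ _ _) => [|i _ s].
    exact: add_continuous.
  apply: (@continuous_comp _ _ _ set_val (fun M : 'rV[R]_m.+1 => M ord0 i)).
    exact: initial_continuous.
  exact: coord_continuous.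
apply: continuous_comp_initial => t B [P nP sPB].
have nPj (j : 'I_n.+1) : nbhs t
    [set s : std_simplex m | P ord0 j (\sum_(i | f i == j) set_val s ord0 i)].
  by apply: (coordc j t); have := nP ord0 j; rewrite /= mxE.
have nPall := @filter_forall _ _ _ (nbhs t) (nbhs_filter t) nPj.
apply: (filterS _ nPall) => s sP.
by apply: sPB => i j /=; rewrite ord1 mxE; exact: sP.
Qed.

HB.instance Definition _ m n (f : 'I_m.+1 -> 'I_n.+1) :=
  isContinuous.Build _ _ (std_simplex_map f)
    (std_simplex_map_continuous (f := f)).

End StandardSimplex.

Section Realization.
Variables (R : realType) (X : simplicial_set).

(* The disjoint union of the X_n x Delta^n with X_n discrete, i.e. of one copy
   of Delta^n for every n-simplex of X. *)
Definition presentation : topologicalType :=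
  {x : {n : nat & X n} & std_simplex R (tag x)}.

Definition cell n (x : X n) (t : std_simplex R n) : presentation :=
  existT (fun x : {n : nat & X n} => std_simplex R (tag x))
    (existT (fun n => X n : Type) n x) t.

Inductive glue : presentation -> presentation -> Prop :=
| glue_face n (i : 'I_n.+2) (x : X n.+1) (t : std_simplex R n) :
    glue (cell (face i x) t) (cell x (std_simplex_map (lift i) t))
| glue_degen n (i : 'I_n.+1) (x : X n) (t : std_simplex R n.+1) :
    glue (cell (degen i x) t) (cell x (std_simplex_map (codegen i) t)).

Definition glue_equiv (p q : presentation) : bool :=
  `[< clos_refl_sym_trans _ glue p q >].

Lemma glue_equiv_class : equiv_class_of glue_equiv.
Proof.
split=> [p|p q|q p r].
- by apply/asboolP; exact: rst_refl.
- by apply/asboolP/asboolP; exact: rst_sym.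
- by move=> /asboolP pq /asboolP qr; apply/asboolP; exact: rst_trans pq qr.
Qed.

Canonical glue_equiv_rel := EquivRelPack glue_equiv_class.

Definition realization : topologicalType :=
  quotient_topology {eq_quot glue_equiv_rel}.

End Realization.

Section SingularHomology.
Variables (R : realType) (Y : topologicalType) (A : zmodType).
Local Open Scope ring_scope.

Definition singular_simplex (n : nat) : choiceType :=
  continuousType (std_simplex R n) Y.

Definition singular_face n (i : 'I_n.+2) (s : singular_simplex n.+1) :
  singular_simplex n := s \o std_simplex_map (lift i).

Definition singular_chain (n : nat) : zmodType := malg (singular_simplex n) A.

Definition singular_bd n (c : singular_chain n.+1) : singular_chain n :=
  \sum_(s <- msupp c) \sum_(i < n.+2)
    mkmalgU (singular_face i s) (mcoeff s c *~ (-1) ^+ i).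

Definition singular_cycle (n : nat) : set (singular_chain n) :=
  if n is m.+1 then [set c | singular_bd c = 0] else setT.
Arguments singular_cycle : clear implicits.

Definition singular_boundary (n : nat) : set (singular_chain n) :=
  range (@singular_bd n).
Arguments singular_boundary : clear implicits.

(* H_n(Y; A) = 0, where H_n is cycles modulo boundaries. *)
Definition singular_homology_eq0 (n : nat) : Prop :=
  singular_cycle n `<=` singular_boundary n.

End SingularHomology.

Definition E3 (R : realType) (G : groupType) : topologicalType :=
  realization R (E3_sset G).

(* Main.v *)
From HB Require Import structures.
From Stdlib Require Import Relation_Operators.
From mathcomp Require Import all_boot all_order all_algebra.
From mathcomp Require Import generic_quotient ring_quotient finmap.
From mathcomp Require Import all_classical reals topology normedtype sequences.
From mathcomp Require Import zify ring lra.
From mathcomp Require Import -(notations) monalg.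
Require Import Defs.

(* For G of class at most 3 the commutator T(x,y,z) = [x,y,z] is trilinear with
   central values.  The cochain f(x,y) = T(x,y,xy) satisfies
   (df)(x,xa,xb) = 3 T(a,b,x) on affinely nil-2 triples, so the cube hypothesis
   makes it a 1-cocycle of E(3,G), while (df)(1,x,y) = f(x,y) vanishes identically
   only if G is 2-Engel.  If G is 2-Engel, T is alternating and is itself a
   2-cocycle, with (dT)(1,x,y,z) = T(x,y,z).

   Such a cocycle detects a singular cycle that is the boundary of a missing
   simplex as follows.  The barycentric coordinates lam_g (g in G) are continuous
   functions on |E(3,G)|, and elements g at which lam_g(p) > 0 for a common point p
   form an affinely nil-2 tuple.  Subdivide a singular chain until the vertices of
   each small simplex lie in one open star lam_g > 0, then map it to simplicial
   chains by a further combinatorial subdivision that labels every face of a small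
   simplex with such a g.  On simplices of E(3,G) itself this is homotopic to the
   identity by acyclic carriers.  All chain maps are written dually, as functionals
   on cochains, so no free modules are needed.

   Conversely, inserting g as a new first vertex contracts |E(3,G)| if G has class
   at most 2, and contracts each open star in general.  If G is 2-Engel, all triples
   are simplices, and the star contractions show that the class of a path modulo
   boundaries is determined by its endpoints. *)

Set Implicit Arguments.
Unset Strict Implicit.
Unset Printing Implicit Defensive.
Import Order.TTheory GRing.Theory Num.Theory.
Import numFieldNormedType.Exports.
Local Open Scope classical_set_scope.
Local Open Scope quotient_scope.
Local Open Scope ring_scope.

(** * Cochains on lists *)

Section Del.
Variable T : Type.
Implicit Types s : seq T.

Definition del i s := take i s ++ drop i.+1 s.

Lemma del_cons0 x s : del 0 (x :: s) = s.
Proof. by rewrite /del take0 drop1. Qed.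

Lemma del_consS i x s : del i.+1 (x :: s) = x :: del i s.
Proof. by []. Qed.

Lemma size_del i s : (i < size s)%N -> size (del i s) = (size s).-1.
Proof.
elim: s i => [|x s IH] [|i] //=; first by rewrite del_cons0.
by rewrite ltnS => iz; rewrite -/(del i s) IH //; case: s iz {IH}.
Qed.

Lemma nth_del x0 i s j : nth x0 (del i s) j = nth x0 s (bump i j).
Proof.
elim: s i j => [|x s IH] [|i] j; rewrite ?del_cons0 ?nth_nil //.
by rewrite del_consS; case: j => [//|j] /=; rewrite IH /bump ltnS addnS.
Qed.

End Del.

Lemma map_del (T U : Type) (h : T -> U) i (s : seq T) :
  map h (del i s) = del i (map h s).
Proof. by rewrite /del map_cat map_take map_drop. Qed.

Lemma mem_del (T : eqType) i (s : seq T) : {subset del i s <= s}.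
Proof.
by move=> x; rewrite mem_cat => /orP[/mem_take|/mem_drop].
Qed.

Section Cobd.
Variables (T : Type) (B : zmodType).
Implicit Types (f g : seq T -> B) (l : seq T).

(** A list of n+1 elements stands for an n-simplex, and the empty list is a simplex of dimension -1,
    so this is the augmented simplicial coboundary. Read dually, [cobd (fun v => L v f) w] is the
    value of f on L applied to the boundary of w. *)
Definition cobd f l : B := \sum_(i < size l) f (del i l) *~ (-1) ^+ i.

Lemma cobd_nil f : cobd f [::] = 0.
Proof. by rewrite /cobd big_ord0. Qed.

(** Dual of the cone formula bd(x . l) = l - x . bd l; the inductions on coboundaries below rest on
    it. *)
Lemma cobd_cons f x l : cobd f (x :: l) = f l - cobd (fun l => f (x :: l)) l.
Proof.
rewrite /cobd big_ord_recl /= del_cons0 expr0 mulr1z -sumrN; congr (_ + _).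
by apply: eq_bigr => i _; rewrite /bump add1n del_consS exprS mulN1r mulrNz.
Qed.

Lemma cobd1 f x : cobd f [:: x] = f [::].
Proof. by rewrite cobd_cons cobd_nil subr0. Qed.

Lemma eq_cobd f g l :
  (forall i, (i < size l)%N -> f (del i l) = g (del i l)) -> cobd f l = cobd g l.
Proof. by move=> fg; apply: eq_bigr => i _; rewrite fg. Qed.

Lemma cobdB f g l : cobd (fun l => f l - g l) l = cobd f l - cobd g l.
Proof.
by rewrite /cobd -sumrB; apply: eq_bigr => i _; rewrite mulrzBl.
Qed.

Lemma cobd_cobd f l : cobd (cobd f) l = 0.
Proof.
elim: l f => [|x l IH] f; first exact: cobd_nil.
rewrite cobd_cons [X in _ - X](eq_cobd (g := fun l => f l - cobd (fun l => f (x :: l)) l)).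
  by rewrite cobdB IH subr0 subrr.
by move=> i _; rewrite cobd_cons.
Qed.

End Cobd.

Lemma cobd_map (T U : Type) (B : zmodType) (h : T -> U) (f : seq U -> B) l :
  cobd f (map h l) = cobd (fun l => f (map h l)) l.
Proof.
by rewrite /cobd size_map; apply: eq_bigr => i _; rewrite map_del.
Qed.

(** * Subdivision of a simplex with abstract barycenters *)

Section Subdivision.
Variables (P Q : Type) (B : zmodType) (a : seq P -> Q).
Implicit Types (w : seq P) (f g : seq Q -> B).

(* [sdg n w f] is the value of the cochain [f] on the chain defined by the
   barycentric subdivision recursion sd w = a(w) . sd(bd w), where [a] plays the
   role of the barycenter and w has dimension n. *)
Fixpoint sdg n w f : B :=
  if n is m.+1 then cobd (fun v => sdg m v (fun l => f (a w :: l))) w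
  else f [:: a w].

(** The simplices occurring in the subdivided chain: each is the list of barycenters of a descending
    flag of faces of w. *)
Fixpoint sdsupp n w (l : seq Q) : Prop :=
  if n is m.+1 then
    exists i l', [/\ (i < size w)%N, l = a w :: l' & sdsupp m (del i w) l']
  else l = [:: a w].

Lemma sdgS n w f :
  sdg n.+1 w f = cobd (fun v => sdg n v (fun l => f (a w :: l))) w.
Proof. by []. Qed.

Lemma eq_sdg n w f g :
  (forall l, sdsupp n w l -> f l = g l) -> sdg n w f = sdg n w g.
Proof.
elim: n w f g => [|n IH] w f g fg /=; first exact: fg.
by apply: eq_cobd => i iw; apply: IH => l wl; apply: fg; exists i, l.
Qed.

Lemma size_sdsupp n w l : sdsupp n w l -> size l = n.+1.
Proof.
elim: n w l => [|n IH] w l /=; first by move=> ->.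
by move=> [i [l' [_ -> /IH /= ->]]].
Qed.

Lemma sdgB n w f g : sdg n w (fun l => f l - g l) = sdg n w f - sdg n w g.
Proof.
elim: n w f g => [|n IH] w f g //=.
by rewrite -cobdB; apply: eq_cobd => i _; rewrite IH.
Qed.

(** In bd(a(w) . sd(bd w)) = sd(bd w) - a(w) . bd(sd(bd w)) the last term is, by induction, the cone
    over sd(bd(bd w)), hence 0. So subdivision is a chain map. *)
Lemma sdg_cobd n w f : size w = n.+2 ->
  cobd (fun v => sdg n v f) w = sdg n.+1 w (cobd f).
Proof.
elim: n w f => [|n IH] w f sw.
  case: w sw => [|u [|v []]] // _ /=.
  by rewrite !cobd_cons !cobd_nil !subr0 opprB addrA subrK.
have -> : sdg n.+2 w (cobd f) = cobd (fun v => sdg n.+1 v f -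
    sdg n.+1 v (cobd (fun l => f (a w :: l)))) w.
  rewrite sdgS; apply: eq_cobd => i _; rewrite -sdgB; apply: eq_sdg => l _.
  exact: cobd_cons.
rewrite cobdB; set c := (X in _ = _ - X); suff -> : c = 0 by rewrite subr0.
rewrite -[RHS](cobd_cobd (fun v => sdg n v (fun l => f (a w :: l))) w).
by apply: eq_cobd => i iw; rewrite IH // size_del // sw.
Qed.

End Subdivision.

Lemma sdg_map (P P' Q Q' : Type) (B : zmodType) (a : seq P -> Q)
    (a' : seq P' -> Q') (h : P -> P') (h' : Q -> Q') n w (f : seq Q' -> B) :
  (forall v, (0 < size v)%N -> a' (map h v) = h' (a v)) -> size w = n.+1 ->
  sdg a' n (map h w) f = sdg a n w (fun l => f (map h' l)).
Proof.
move=> ah; elim: n w f => [|n IH] w f sw; first by rewrite /= ah ?sw.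
rewrite !sdgS ah ?sw // cobd_map; apply: eq_cobd => i iw.
by rewrite IH // size_del // sw.
Qed.

(** * Chain maps carried by the entries of a simplex *)

Section AcyclicCarrier.
Variables (T : eqType) (B : zmodType) (E : seq T -> Prop).
Variable ell : seq T -> (seq T -> B) -> B.
Hypothesis E_del : forall i x, E x -> E (del i x).
Hypothesis ellB : forall x f g,
  ell x (fun l => f l - g l) = ell x f - ell x g.
Hypothesis eq_ell : forall x f g, E x -> (0 < size x)%N ->
  (forall l, size l = size x -> {subset l <= x} -> f l = g l) ->
  ell x f = ell x g.
Hypothesis ell_cobd : forall x f, E x -> (1 < size x)%N ->
  cobd (fun v => ell v f) x = ell x (cobd f).
Hypothesis ell_const : forall x c, size x = 1%N -> ell x (fun=> c) = c.

(* The chain homotopy between [ell] and the identity, obtained by coning off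
   with the first vertex. *)
Fixpoint carrier_htpy n (x : seq T) (f : seq T -> B) : B :=
  if n is m.+1 then
    if x is x0 :: _ then
      ell x (fun l => f (x0 :: l)) - f (x0 :: x) -
      cobd (fun v => carrier_htpy m v (fun l => f (x0 :: l))) x
    else 0
  else 0.

Let D := carrier_htpy.

Lemma carrier_htpyB n x f g :
  D n x (fun l => f l - g l) = D n x f - D n x g.
Proof.
elim: n x f g => [|n IH] [|x0 x] f g //=; rewrite ?subrr //.
rewrite ellB (eq_cobd (g := fun v => D n v (fun l => f (x0 :: l)) -
  D n v (fun l => g (x0 :: l)))); last by move=> i _; rewrite IH.
by rewrite cobdB !opprB !addrA [LHS](ACl (1*4*6*5*3*2)).
Qed.

Lemma eq_carrier_htpy n x f g : E x -> size x = n ->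
  (forall l, size l = n.+1 -> {subset l <= x} -> f l = g l) ->
  D n x f = D n x g.
Proof.
elim: n x f g => [|n IH] [|x0 x] f g Ex //= [sx] fg.
congr (_ - _ - _).
- apply: eq_ell => // l sl lx; apply: fg; first by rewrite /= sl /= sx.
  by move=> y; rewrite inE => /orP[/eqP ->|/lx//]; rewrite mem_head.
- by apply: fg; [rewrite /= sx|move=> y; rewrite inE => /orP[/eqP ->|//]; rewrite mem_head].
- apply: eq_cobd => i ix; apply: IH; first exact: E_del.
    by rewrite size_del //= sx.
  move=> l sl lx; apply: fg; first by rewrite /= sl.
  by move=> y; rewrite inE => /orP[/eqP ->|/lx/mem_del//]; rewrite mem_head.
Qed.

(** The simplices with entries in x form an acyclic complex: coning with the first entry of x turns
    the cycle given by [ell] minus the identity minus D(bd x) into a boundary. The augmentation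
    condition [ell_const] starts the induction. *)
Lemma carrier_htpyP n x f : E x -> size x = n.+1 ->
  ell x f - f x = D n.+1 x (cobd f) + cobd (fun v => D n v f) x.
Proof.
elim: n x f => [|n IH] x f Ex sx.
  case: x sx Ex => [//|x0 [|//]] _ Ex /=.
  rewrite !cobd1 addr0 subr0 cobd_cons cobd1.
  have -> : ell [:: x0] (fun l => cobd f (x0 :: l)) =
      ell [:: x0] (fun l => f l - f [:: x0]).
    by apply: eq_ell => // -[|y [|? ?]] // _ _; rewrite cobd_cons cobd1.
  by rewrite ellB ell_const // subrr subr0.
case: x sx Ex => [//|x0 x] sx Ex; set X := x0 :: x.
pose f0 l := f (x0 :: l).
have E0 l : cobd f (x0 :: l) = f l - cobd f0 l by exact: cobd_cons.
have -> : D n.+2 X (cobd f) = (ell X f - ell X (cobd f0)) - (f X - cobd f0 X) -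
    cobd (fun v => D n.+1 v f - D n.+1 v (cobd f0)) X.
  transitivity (ell X (fun l => cobd f (x0 :: l)) - cobd f (x0 :: X) -
    cobd (fun v => D n.+1 v (fun l => cobd f (x0 :: l))) X); first by [].
  rewrite E0 -ellB; congr (_ - _ - _).
    by apply: eq_ell => // l _ _; exact: E0.
  apply: eq_cobd => i iX; rewrite -carrier_htpyB.
  apply: eq_carrier_htpy; first exact: E_del.
    by rewrite size_del // sx.
  by move=> l _ _; exact: E0.
rewrite cobdB -ell_cobd ?sx //.
have -> : cobd (fun v => D n.+1 v (cobd f0)) X =
    cobd (fun v => ell v f0) X - cobd f0 X.
  rewrite -[RHS]subr0 -[X in _ = _ - X](cobd_cobd (fun v => D n v f0) X) -!cobdB.
  apply: eq_cobd => i iX; rewrite IH ?addrK //; first exact: E_del.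
  by rewrite size_del // sx.
move: (cobd (fun v => D n.+1 v f) X) (cobd (fun v => ell v f0) X) => u v.
move: (cobd f0 X) (ell X f) (f X) => {}w p q.
by rewrite !opprB !addrA subrK [RHS](ACl (1*4*(5*2)*(3*6))) /= !subrr !addr0.
Qed.

(** Here only the faces of X satisfy E, not X itself. On the sphere bd X the difference of [ell] and
    the identity is a homotopy term in [cobd f], which vanishes because f is a cocycle on lists
    carried by a face, plus a term that is a double coboundary. *)
Lemma ell_cobd_sphere X f : (1 < size X)%N ->
  (forall i, (i < size X)%N -> E (del i X)) ->
  (forall l, E l -> forall l', size l' = size X -> {subset l' <= l} ->
     cobd f l' = 0) ->
  cobd (fun v => ell v f) X = cobd f X.
Proof.
case sX : (size X) => [//|[//|n]] _ EX f0.
apply/eqP; rewrite -subr_eq0 -cobdB -(cobd_cobd (fun v => D n v f) X).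
apply/eqP; apply: eq_cobd => i iX.
have sd : size (del i X) = n.+1 by rewrite size_del // sX.
rewrite sX in iX; rewrite (carrier_htpyP (n := n)) //; last exact: EX.
have -> : D n.+1 (del i X) (cobd f) = D n.+1 (del i X) (fun _ => 0 - 0).
  apply: eq_carrier_htpy => [||l sl lx]; rewrite ?subr0 ?sd //; first exact: EX.
  by apply: (f0 _ (EX _ iX)) lx; rewrite sl.
by rewrite carrier_htpyB subrr add0r.
Qed.

End AcyclicCarrier.

(** * The trilinear commutator *)

Section Subgroups.
Variable G : groupType.
Local Open Scope group_scope.
Implicit Types (H K A : set G).

Lemma generated_subgroup A : is_subgroup (generated A).
Proof.
split=> [|x y Ax Ay|x Ax] K [sK AK].
- by case: sK.
- by case: (sK) => _ + _; apply; [exact: Ax|exact: Ay].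
- by case: (sK) => _ _; apply; exact: Ax.
Qed.

Lemma sub_generated A : A `<=` generated A.
Proof. by move=> x Ax K [_]; apply. Qed.

Lemma generated_min A H : is_subgroup H -> A `<=` H -> generated A `<=` H.
Proof. by move=> sH AH x; apply. Qed.

Lemma commutator_subgroup_gen H K x y :
  H x -> K y -> commutator_subgroup H K [~ x, y].
Proof. by move=> Hx Ky; apply: sub_generated; exists x, y. Qed.

Lemma centraliser_subgroup A : is_subgroup [set x | forall y, A y -> commute x y].
Proof.
split=> /= [y _|x y Ax Ay z Az|x Ax y Ay].
- exact/commute_sym/commute1.
- by apply/commute_sym/commuteM; apply/commute_sym; [exact: Ax|exact: Ay].
- by apply/commute_sym/commuteV/commute_sym/Ax.
Qed.

Lemma trivial_subgroup : is_subgroup [set (1 : G)].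
Proof. by split=> [//|_ _ -> ->|_ ->]; rewrite ?mulg1 ?invg1. Qed.

(** The elements commuting with all of H form a subgroup, so centrality of [H,H] in H can be tested
    on the generators [a,b]. *)
Lemma nilpotent2P H : is_subgroup H ->
  nilpotent_class_le 2 H <->
  (forall a b c, H a -> H b -> H c -> [~ [~ a, b], c] = 1).
Proof.
move=> sH; split=> [nH a b c Ha Hb Hc|nH].
  suff : lower_central 3 H [~ [~ a, b], c] by rewrite nH.
  by do 2!apply: commutator_subgroup_gen => //.
apply/seteqP; split=> [x|_ ->]; last by case: (generated_subgroup
    [set z | exists x y, [/\ commutator_subgroup H H x, H y & z = [~ x, y]]]).
apply: generated_min => [|_ [u [v [Hu Hv ->]]]]; first exact: trivial_subgroup.
apply/eqP/commgP; move: u Hu v Hv.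
apply: generated_min => [|_ [a [b [Ha Hb ->]]] c Hc].
  exact: centraliser_subgroup.
by apply/commgP/eqP; exact: nH.
Qed.

Lemma nilpotent3_central : nilpotent_class_le 3 [set: G] ->
  forall x y z, group_center G [~ [~ x, y], z].
Proof.
move=> nG x y z w; apply/commgP/eqP.
suff : lower_central 4 [set: G] [~ [~ [~ x, y], z], w] by rewrite nG.
by do 3!apply: commutator_subgroup_gen => //.
Qed.

End Subgroups.

Section NilTuples.
Variable G : groupType.
Local Open Scope group_scope.

Definition nil2 (l : seq G) : Prop := exists (y : G) (H : set G),
  [/\ is_subgroup H, nilpotent_class_le 2 H & forall g, g \in l -> H (y^-1 * g)].

Lemma nil2_sub l l' : {subset l <= l'} -> nil2 l' -> nil2 l.
Proof.
by move=> ll' [y [H [sH nH lH]]]; exists y, H; split=> // g /ll'; exact: lH.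
Qed.

(** A coset is yH = xH for each of its elements x, so any entry may serve as base point. *)
Lemma nil2_pivot l x : nil2 l -> x \in l -> exists H : set G,
  [/\ is_subgroup H, nilpotent_class_le 2 H & forall g, g \in l -> H (x^-1 * g)].
Proof.
move=> [y [H [sH nH lH]]] xl; exists H; split=> // g gl.
have -> : x^-1 * g = (y^-1 * x)^-1 * (y^-1 * g).
  by rewrite invgM invgK -mulgA [y * _]mulgA mulgV mul1g.
case: sH => _ HM HV; apply: HM; last exact: lH.
by apply: HV; exact: lH.
Qed.

End NilTuples.

Section CenterGroup.
Variable G : groupType.
Local Open Scope group_scope.

(** The center, to be written additively: it is the coefficient group of the commutator cochains. *)
Definition centerT := set_type (group_center G).
HB.instance Definition _ := Choice.on centerT.

Lemma centerT_central (x : centerT) (y : G) : set_val x * y = y * set_val x.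
Proof. exact: (set_valP x). Qed.

Lemma center_mul_subproof (x y : centerT) :
  set_val x * set_val y \in group_center G.
Proof.
by apply/mem_set => z; apply/commute_sym/commuteM; apply/commute_sym;
  exact: centerT_central.
Qed.

Lemma center_inv_subproof (x : centerT) : (set_val x)^-1 \in group_center G.
Proof.
apply/mem_set => z; apply/commute_sym/commuteV/commute_sym.
exact: centerT_central.
Qed.

Lemma center_one_subproof : (1 : G) \in group_center G.
Proof. by apply/mem_set => z; rewrite mulg1 mul1g. Qed.

Definition center_mul (x y : centerT) : centerT := SigSub (center_mul_subproof x y).
Definition center_inv (x : centerT) : centerT := SigSub (center_inv_subproof x).
Definition center_one : centerT := SigSub center_one_subproof.

Lemma center_mulA : associative center_mul.
Proof. by move=> x y z; apply: val_inj; rewrite /= mulgA. Qed.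
Lemma center_mulC : commutative center_mul.
Proof. by move=> x y; apply: val_inj; rewrite /= centerT_central. Qed.
Lemma center_mul1 : left_id center_one center_mul.
Proof. by move=> x; apply: val_inj; rewrite /= mul1g. Qed.
Lemma center_mulV : left_inverse center_one center_inv center_mul.
Proof. by move=> x; apply: val_inj; rewrite /= mulVg. Qed.

HB.instance Definition _ := GRing.isZmodule.Build centerT
  center_mulA center_mulC center_mul1 center_mulV.

Definition to_center (x : G) : centerT := insubd center_one x.

Lemma to_centerK x : group_center G x -> set_val (to_center x) = x.
Proof. by move=> cx; exact: (insubdK _ (mem_set cx)). Qed.

Lemma to_centerM x y : group_center G x -> group_center G y ->
  to_center (x * y) = (to_center x + to_center y)%R.
Proof.
move=> cx cy; apply: val_inj.
transitivity (x * y); last first.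
  transitivity (set_val (to_center x) * set_val (to_center y)) => //.
  by rewrite !to_centerK.
apply: to_centerK.
by move=> z; apply/commute_sym/commuteM; apply/commute_sym; [exact: cx|exact: cy].
Qed.

Lemma to_center1 : to_center 1 = 0%R.
Proof.
by apply: val_inj; rewrite [LHS]to_centerK // => z; rewrite mulg1 mul1g.
Qed.

Lemma to_center_eq0 x : group_center G x -> to_center x = 0%R -> x = 1.
Proof. by move=> cx x0; rewrite -(to_centerK cx) x0. Qed.

Lemma to_centerX x n : group_center G x -> to_center (x ^+ n) = (to_center x *+ n)%R.
Proof.
move=> cx; elim: n => [|n IH]; first by rewrite expg0 mulr0n to_center1.
rewrite expgS to_centerM ?IH ?mulrS // => z.
by apply/commute_sym/commuteX/commute_sym.
Qed.

End CenterGroup.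

(** * Identities and cocycles from T(x,y,z) = [x,y,z] *)

Section ClassThree.
Variable G : groupType.
Local Open Scope ring_scope.
Hypothesis class3 : forall x y z : G, group_center G [~ [~ x, y], z]%g.
Implicit Types x y z : G.

Definition triple x y z : centerT G := to_center [~ [~ x, y], z]%g.
Local Notation T := triple.

Local Lemma commMg x y z : ([~ x * y, z] = [~ x, z] ^ y * [~ y, z])%g.
Proof. by rewrite /commg /conjg !gnorm. Qed.

Local Lemma commgM x y z : ([~ x, y * z] = [~ x, z] * [~ x, y] ^ z)%g.
Proof. by rewrite /commg /conjg !gnorm. Qed.

Local Lemma center_conj (c x : G) : group_center G c -> (c ^ x = c)%g.
Proof. by move=> cc; apply/conjg_fixP/commgP; exact: cc. Qed.

Local Lemma comm_center (c x : G) : group_center G c -> ([~ c, x] = 1)%g.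
Proof. by move=> cc; apply/eqP/commgP; exact: cc. Qed.

(** Conjugation by w changes [x,y] only by the factor [x,y,w], which is central and drops out of the
    outer commutator. *)
Local Lemma comm2J x y w z : ([~ [~ x, y] ^ w, z] = [~ [~ x, y], z])%g.
Proof.
have -> : ([~ x, y] ^ w = [~ x, y] * [~ [~ x, y], w])%g.
  by rewrite [X in (_ * X)%g]/commg mulgA mulgV mul1g.
by rewrite commMg center_conj // [X in (_ * X)%g]comm_center // mulg1.
Qed.

Lemma tripleDl x x' y z : T (x * x')%g y z = T x y z + T x' y z.
Proof.
rewrite /T commMg commMg -to_centerM //; congr to_center.
by rewrite center_conj ?comm2J // -[X in group_center G X]comm2J => //; rewrite comm2J.
Qed.

Lemma tripleDm x y y' z : T x (y * y')%g z = T x y z + T x y' z.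
Proof.
rewrite /T commgM commMg -to_centerM //; congr to_center.
rewrite center_conj // comm2J; exact: class3.
Qed.

Lemma tripleDr x y z z' : T x y (z * z')%g = T x y z + T x y z'.
Proof.
rewrite /T commgM addrC -to_centerM //; congr to_center.
by rewrite center_conj.
Qed.

Lemma triplexx x z : T x x z = 0.
Proof. by rewrite /T commgg comm1g to_center1. Qed.

Lemma triple1l y z : T 1%g y z = 0.
Proof. by rewrite /T !comm1g to_center1. Qed.

Lemma triple1m y z : T y 1%g z = 0.
Proof. by rewrite /T commg1 comm1g to_center1. Qed.

Lemma tripleNm x y z : T x y^-1%g z = - T x y z.
Proof.
by apply/eqP; rewrite -subr_eq0 opprK -tripleDm mulVg triple1m.
Qed.

(** Polarization of T(xy,xy,z) = 0. *)
Lemma triple_antisym x y z : T y x z = - T x y z.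
Proof.
apply/eqP; rewrite -subr_eq0 opprK.
have := triplexx (x * y)%g z.
by rewrite tripleDl !tripleDm !triplexx add0r addr0 addrC => ->.
Qed.

Local Lemma Hall_Witt x y z : ([~ [~ x, y^-1], z] ^ y *
  [~ [~ y, z^-1], x] ^ z * [~ [~ z, x^-1], y] ^ x = 1)%g.
Proof. by rewrite /commg /conjg !gnorm. Qed.

(** The Hall-Witt identity has central factors here, so its conjugations disappear; the inverse in
    the second slot of each term gives a common sign. *)
Lemma triple_Jacobi x y z : T x y z + T y z x + T z x y = 0.
Proof.
have : T x y^-1%g z + T y z^-1%g x + T z x^-1%g y = 0.
  rewrite /T -!to_centerM //; last first.
    by move=> w; apply/commute_sym/commuteM; apply/commute_sym; exact: class3.
  by have := Hall_Witt x y z; rewrite !center_conj // => ->; rewrite to_center1.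
by rewrite !tripleNm -!opprD => /eqP; rewrite oppr_eq0 => /eqP.
Qed.


(** T(x,y,xy), expanded by additivity in the third argument. *)
Definition engel_cochain (l : seq G) : centerT G :=
  if l is [:: x; y] then T x y x + T x y y else 0.

Definition triple_cochain (l : seq G) : centerT G :=
  if l is [:: x; y; z] then T x y z else 0.

Lemma triple_eq0 x y z : T x y z = 0 -> ([~ [~ x, y], z] = 1)%g.
Proof. exact/to_center_eq0/class3. Qed.

Lemma nilpotent2_triple (H : set G) : is_subgroup H ->
  nilpotent_class_le 2 H <->
  (forall a b c, H a -> H b -> H c -> T a b c = 0).
Proof.
move=> sH; split=> [/(nilpotent2P sH) nH a b c Ha Hb Hc|nH].
  by rewrite /T nH // to_center1.
by apply/(nilpotent2P sH) => a b c Ha Hb Hc; exact/triple_eq0/nH.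
Qed.

Local Lemma additive_kernel (h : G -> centerT G) :
  (forall x y, h (x * y)%g = h x + h y) -> is_subgroup [set x | h x = 0].
Proof.
move=> hM; have h1 : h 1%g = 0.
  by apply: (addrI (h 1%g)); rewrite -hM mulg1 addr0.
split=> [//|x y /= hx hy|x /= hx]; first by rewrite hM hx hy addr0.
by apply: (addrI (h x)); rewrite -hM mulgV h1 hx addr0.
Qed.

Local Lemma subgroup_bigcap (I : Type) (D : set I) (F : I -> set G) :
  (forall i, is_subgroup (F i)) -> is_subgroup [set x | forall i, D i -> F i x].
Proof.
move=> sF; split=> [i _|x y Fx Fy i Di|x Fx i Di]; case: (sF i) => // F1 FM FV.
- by apply: FM; [exact: Fx|exact: Fy].
- by apply: FV; exact: Fx.
Qed.

(** By trilinearity and antisymmetry the two hypotheses make T vanish on a and b in all slots.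
    Kernels of additive maps are subgroups, so the vanishing extends to the subgroup generated by a
    and b, in the third slot, then the second, then the first. *)
Lemma nil2_triple x a b : T a b a = 0 -> T a b b = 0 ->
  nil2 [:: x; x * a; x * b]%g.
Proof.
move=> aba abb; pose H := generated [set a; b].
have sH : is_subgroup H by exact: generated_subgroup.
have Ha : H a by apply: sub_generated; left.
have Hb : H b by apply: sub_generated; right.
have H1 w : H w -> T a b w = 0.
  move: w; apply: (@generated_min _ _ [set w | T a b w = 0]).
    by apply: additive_kernel => *; rewrite tripleDr.
  by move=> _ [|] ->.
have H2 u v : (u = a \/ u = b) -> H v -> forall w, H w -> T u v w = 0.
  move=> uab; move: v.
  apply: (@generated_min _ _ [set v | forall w, H w -> T u v w = 0]).
    apply: (@subgroup_bigcap _ H (fun w => [set v | T u v w = 0])) => w.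
    by apply: additive_kernel => *; rewrite tripleDm.
  move=> _ [|] -> w Hw; case: uab => ->; rewrite ?triplexx ?H1 //.
  by rewrite triple_antisym H1 // oppr0.
have H3 u : H u -> forall vw, (H vw.1 /\ H vw.2) -> T u vw.1 vw.2 = 0.
  move: u; apply: (@generated_min _ _
    [set u | forall vw, H vw.1 /\ H vw.2 -> T u vw.1 vw.2 = 0]).
    apply: (@subgroup_bigcap _ (fun vw => H vw.1 /\ H vw.2)
      (fun vw => [set u | T u vw.1 vw.2 = 0])) => vw.
    by apply: additive_kernel => *; rewrite tripleDl.
  by move=> u uab [v w] /= [Hv Hw]; apply: H2.
exists x, H; split=> //.
  by apply/nilpotent2_triple => // u v w Hu Hv Hw; apply: (H3 u Hu (v, w)).
move=> g; rewrite !inE => /or3P[] /eqP ->.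
- by rewrite mulVg; case: sH.
- by rewrite mulgA mulVg mul1g.
- by rewrite mulgA mulVg mul1g.
Qed.

Lemma nil2_pair x y : nil2 [:: x; y].
Proof.
apply: (@nil2_sub _ _ [:: x; x * (x^-1 * y); x * (x^-1 * y)]%g).
  by move=> g; rewrite !inE mulgA mulgV mul1g => /orP[] ->; rewrite ?orbT.
by apply: nil2_triple; rewrite triplexx.
Qed.

(** Here p, q, r stand for T(x,b,-), T(x,a,-), T(a,b,-), and the second letter is the third
    argument; the left side is the coboundary of [engel_cochain] at (x, xa, xb). *)
Local Lemma engel_identity (V : zmodType) (px pa pb qx qa qb rx : V) :
  px + pa + (- qx - qa + rx) + (px + pb + (- qx - qb + rx)) -
  (px + (px + pb) - (qx + (qx + qa))) = pa - qb + rx + rx.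
Proof.
rewrite opprB !opprD !addrA.
rewrite [LHS](ACl ((2*9*5*10)*(1*14)*(6*15)*(7*16)*(3*11)*(8*12)*(4*13))) /=.
by rewrite !subrr !addNr !addr0.
Qed.

Lemma engel_cochain_cocycle l :
  (forall H : set G, is_subgroup H -> nilpotent_class_le 2 H ->
    power_subgroup 3 (commutator_subgroup H H) `<=` group_center G) ->
  nil2 l -> size l = 3%N -> cobd engel_cochain l = 0.
Proof.
move=> cube; case: l => [|x [|y [|z []]]] // nl _.
have [H [sH nH lH]] := nil2_pivot nl (mem_head _ _).
have xH g : g \in [:: x; y; z] -> exists2 a, g = (x * a)%g & H a.
  by move=> /lH Hg; exists (x^-1 * g)%g => //; rewrite mulgA mulgV mul1g.
have [|a -> Ha] := xH y; first by rewrite !inE eqxx orbT.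
have [|b -> Hb] := xH z; first by rewrite !inE eqxx !orbT.
have TH := (nilpotent2_triple sH).1 nH.
have aba : T a b a = 0 by exact: TH.
have abb : T a b b = 0 by exact: TH.
(* The only use of the cube hypothesis: [a,b]^3 is central, and [[a,b]^3, x] is the cube of
   [a,b,x]. *)
have abx : T a b x *+ 3 = 0.
  rewrite -to_centerX // -[RHS](to_center1 G); congr to_center.
  have Hc := commutator_subgroup_gen Ha Hb.
  have : group_center G ([~ a, b] ^+ 3)%g.
    by apply: (cube H sH nH); apply: sub_generated; exists [~ a, b]%g.
  move=> /(_ x) /commgP/eqP <-.
  rewrite !expgS !expg0 !mulg1 (commMg [~ a, b] ([~ a, b] * [~ a, b])%g).
  by rewrite (commMg [~ a, b] [~ a, b]) !center_conj.
rewrite !cobd_cons !cobd_nil /= !subr0.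
rewrite !(tripleDl, tripleDm, tripleDr, triplexx, aba, abb) !(add0r, addr0).
rewrite !(triple_antisym x a) engel_identity.
(* What remains is T(x,b,a) - T(x,a,b) + 2 T(a,b,x); the Jacobi identity turns the difference into
   one more T(a,b,x). *)
have := triple_Jacobi x b a; rewrite (triple_antisym x a) (triple_antisym a b).
by rewrite addrAC => /eqP; rewrite subr_eq0 => /eqP ->; move: abx; rewrite mulrS mulr2n addrA.
Qed.

(** The 2-Engel law makes T alternating, hence cyclically invariant. At (x, xa, xb, xc) every term
    of the coboundary containing x then cancels, leaving T(a,b,c), which vanishes in a subgroup of
    class 2. *)
Lemma triple_cochain_cocycle l : (forall x y, T x y y = 0) ->
  nil2 l -> size l = 4%N -> cobd triple_cochain l = 0.
Proof.
move=> engel; case: l => [|x [|y [|z [|w []]]]] // nl _.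
have [H [sH nH lH]] := nil2_pivot nl (mem_head _ _).
have engel' u v : T u v u = 0 by rewrite triple_antisym engel oppr0.
have alt u v t : T u v t = - T u t v.
  apply/eqP; rewrite -subr_eq0 opprK; have := engel u (v * t)%g.
  by rewrite tripleDm !tripleDr !engel add0r addr0 => ->.
have cyc u v t : T u v t = T v t u.
  by rewrite triple_antisym alt opprK.
have xH g : g \in [:: x; y; z; w] -> exists2 a, g = (x * a)%g & H a.
  by move=> /lH Hg; exists (x^-1 * g)%g => //; rewrite mulgA mulgV mul1g.
have [|a -> Ha] := xH y; first by rewrite !inE eqxx orbT.
have [|b -> Hb] := xH z; first by rewrite !inE eqxx !orbT.
have [|c -> Hc] := xH w; first by rewrite !inE eqxx !orbT.
have abc : T a b c = 0 by apply: ((nilpotent2_triple sH).1 nH).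
rewrite !cobd_cons !cobd_nil /= !subr0.
rewrite !(tripleDl, tripleDm, tripleDr, triplexx, engel, engel', abc).
rewrite !(add0r, addr0).
rewrite (triple_antisym x a c) -(cyc x a b) opprB !addrA.
by rewrite [LHS](ACl ((1*6)*(2*4)*(3*5))) /= !subrr addNr !addr0.
Qed.

(** With f the cochain, f(xy,y) - f(x,y) = T(x,y,y). *)
Lemma engel_of_cochain x y :
  (forall x y, engel_cochain [:: x; y] = 0) -> T x y y = 0.
Proof.
move=> e0; have := e0 (x * y)%g y; rewrite /= !tripleDl !tripleDr !triplexx.
have /= exy := e0 x y; by rewrite !addr0 exy add0r.
Qed.

(** Torsion by e is what lets coefficients in Z/e act on the values of the cochains. *)
Lemma cochain_torsion e l :
  (forall x, lower_central 3 [set: G] x -> (x ^+ e = 1)%g) ->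
  engel_cochain l *+ e = 0 /\ triple_cochain l *+ e = 0.
Proof.
move=> ex; have Te x y z : T x y z *+ e = 0.
  rewrite -to_centerX // ex ?to_center1 //.
  by do 2!apply: commutator_subgroup_gen => //.
by split; case: l => [|x [|y [|z [|]]]] *; rewrite /= ?mulrnDl ?Te ?addr0 ?mul0rn.
Qed.

End ClassThree.

(** * Singular chains *)

Section LinearExtension.
Variables (K : choiceType) (A B : zmodType).
Implicit Types (phi : K -> A -> B) (c d : malg K A).

Definition lin phi c : B := \sum_(s <- msupp c) phi s (mcoeff s c).

Definition additive_at phi := forall s, {morph phi s : x y / x + y}.

Variable phi : K -> A -> B.
Hypothesis phiD : additive_at phi.

Lemma lin_at0 s : phi s 0 = 0.
Proof. by apply: (addrI (phi s 0)); rewrite -phiD !addr0. Qed.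

Lemma lin_atN s x : phi s (- x) = - phi s x.
Proof. by apply: (addrI (phi s x)); rewrite -phiD !subrr lin_at0. Qed.

Lemma linEw c (D : {fset K}) : (msupp c `<=` D)%fset ->
  lin phi c = \sum_(s <- D) phi s (mcoeff s c).
Proof.
move=> cD; apply: big_fset_incl => // s _ /mcoeff_outdom ->.
exact: lin_at0.
Qed.

Lemma linD c d : lin phi (c + d) = lin phi c + lin phi d.
Proof.
pose D := (msupp c `|` msupp d)%fset.
rewrite (linEw (D := D)) ?msuppD_le // (linEw (c := c) (D := D)) ?fsubsetUl //.
rewrite (linEw (c := d) (D := D)) ?fsubsetUr // -big_split /=.
by apply: eq_bigr => s _; rewrite mcoeffD phiD.
Qed.

Lemma lin0 : lin phi 0 = 0.
Proof. by apply: (addrI (lin phi 0)); rewrite -linD !addr0. Qed.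

Lemma linN c : lin phi (- c) = - lin phi c.
Proof. by apply: (addrI (lin phi c)); rewrite -linD !subrr lin0. Qed.

Lemma linU s x : lin phi (mkmalgU s x) = phi s x.
Proof.
rewrite (linEw (D := [fset s]%fset)) ?msuppU_le // big_seq_fset1.
by rewrite mcoeffUU.
Qed.

Lemma lin_sum (I : Type) (r : seq I) (P : pred I) (F : I -> malg K A) :
  lin phi (\sum_(i <- r | P i) F i) = \sum_(i <- r | P i) lin phi (F i).
Proof. exact: (big_morph _ linD lin0). Qed.

Lemma linMz c (m : int) : lin phi (c *~ m) = lin phi c *~ m.
Proof.
have linMn n : lin phi (c *+ n) = lin phi c *+ n.
  by elim: n => [|n IH]; rewrite ?mulr0n ?lin0 // !mulrS linD IH.
by case: m => n; rewrite ?NegzE -?pmulrn ?mulrNz ?linN -?pmulrn linMn.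
Qed.

End LinearExtension.

Section Chains.
Variables (R : realType) (Y : topologicalType) (A : zmodType).
Implicit Types n : nat.

Definition bd_at n (s : singular_simplex R Y n.+1) (x : A) :
    singular_chain R Y A n :=
  \sum_(i < n.+2) mkmalgU (singular_face i s) (x *~ (-1) ^+ i).

Lemma singular_bdE n (c : singular_chain R Y A n.+1) :
  singular_bd c = lin (@bd_at n) c.
Proof. by []. Qed.

Lemma bd_atD n : additive_at (@bd_at n).
Proof.
move=> s x y; rewrite /bd_at -big_split; apply: eq_bigr => i _ /=.
by rewrite mulrzDl monalgUD.
Qed.

Lemma singular_bdU n (s : singular_simplex R Y n.+1) x :
  singular_bd (mkmalgU s x : singular_chain R Y A n.+1) = bd_at s x.
Proof. by rewrite singular_bdE linU //; exact: bd_atD. Qed.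

Lemma singular_bdD n (c d : singular_chain R Y A n.+1) :
  singular_bd (c + d) = singular_bd c + singular_bd d.
Proof. by rewrite singular_bdE linD //; exact: bd_atD. Qed.

Lemma singular_bdN n (c : singular_chain R Y A n.+1) :
  singular_bd (- c) = - singular_bd c.
Proof. by rewrite singular_bdE linN //; exact: bd_atD. Qed.

Lemma singular_bd_sum n (I : Type) (r : seq I) (P : pred I)
    (F : I -> singular_chain R Y A n.+1) :
  singular_bd (\sum_(i <- r | P i) F i) = \sum_(i <- r | P i) singular_bd (F i).
Proof. by rewrite singular_bdE lin_sum //; exact: bd_atD. Qed.

Lemma singular_bd0 n : singular_bd (0 : singular_chain R Y A n.+1) = 0.
Proof. by rewrite singular_bdE lin0 //; exact: bd_atD. Qed.

Lemma lin_singular_bd (B : zmodType) n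
    (phi : singular_simplex R Y n -> A -> B) (c : singular_chain R Y A n.+1) :
  additive_at phi ->
  lin phi (singular_bd c) =
  lin (fun s x => \sum_(i < n.+2) phi (singular_face i s) (x *~ (-1) ^+ i)) c.
Proof.
move=> phiD; rewrite /singular_bd lin_sum //; apply: eq_bigr => s _.
by rewrite lin_sum //; apply: eq_bigr => i _; rewrite linU.
Qed.

End Chains.

(** * Points of the standard simplex *)

Section SimplexPoints.
Variable R : realType.
Local Notation simplex := (std_simplex R).

Definition bcoord n (t : simplex n) (j : 'I_n.+1) : R := set_val t ord0 j.

Lemma bcoord_ge0 n (t : simplex n) j : 0 <= bcoord t j.
Proof. by have /= [t0 _] := set_valP t; exact: t0. Qed.

Lemma bcoord_sum n (t : simplex n) : \sum_j bcoord t j = 1.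
Proof. by have /= [_] := set_valP t. Qed.

Lemma bcoord_le1 n (t : simplex n) j : bcoord t j <= 1.
Proof.
rewrite -(bcoord_sum t) (bigD1 j) //= lerDl; apply: sumr_ge0 => i _.
exact: bcoord_ge0.
Qed.

Lemma bcoord_inj n (s t : simplex n) : bcoord s =1 bcoord t -> s = t.
Proof.
by move=> st; apply: val_inj; apply/rowP => j; exact: st.
Qed.

Lemma bcoord_map m n (f : 'I_m.+1 -> 'I_n.+1) (t : simplex m) j :
  bcoord (std_simplex_map f t) j = \sum_(i | f i == j) bcoord t i.
Proof. by rewrite /bcoord /= mxE. Qed.

Lemma std_simplex_map_comp m n p (f : 'I_m.+1 -> 'I_n.+1)
    (g : 'I_n.+1 -> 'I_p.+1) (t : simplex m) :
  std_simplex_map g (std_simplex_map f t) = std_simplex_map (g \o f) t.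
Proof.
apply: bcoord_inj => j; rewrite !bcoord_map.
rewrite [RHS](partition_big f (fun i => g i == j)) //=.
apply: eq_bigr => i gij; rewrite bcoord_map; apply: eq_bigl => k.
by apply/eqP/andP => [fki|[_ /eqP]//]; rewrite /= fki gij.
Qed.

Lemma std_simplex_map_id n (t : simplex n) : std_simplex_map id t = t.
Proof.
by apply: bcoord_inj => j; rewrite bcoord_map big_pred1_eq.
Qed.

Lemma bcoord_map_lift n (i j : 'I_n.+2) (t : simplex n) :
  bcoord (std_simplex_map (lift i) t) j =
  if unlift i j is Some k then bcoord t k else 0.
Proof.
rewrite bcoord_map; case: unliftP => [k ->|->].
  by rewrite (big_pred1 k) // => l; rewrite /= (inj_eq lift_inj).
by rewrite big_pred0 // => l; apply/negbTE; rewrite eq_sym neq_lift.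
Qed.

Lemma vertex_subproof n (i : 'I_n.+1) :
  (\row_j (j == i)%:R : 'rV[R]_n.+1) \in @std_simplex_set R n.
Proof.
apply/mem_set; split=> [j|]; first by rewrite mxE ler0n.
rewrite (bigD1 i) //= mxE eqxx big1 ?addr0 // => j /negbTE ji.
by rewrite mxE ji.
Qed.

Definition vertex n (i : 'I_n.+1) : simplex n := SigSub (vertex_subproof i).

Lemma bcoord_vertex n (i j : 'I_n.+1) : bcoord (vertex i) j = (j == i)%:R.
Proof. by rewrite /bcoord /= mxE. Qed.

Lemma vertex_map m n (f : 'I_m.+1 -> 'I_n.+1) i :
  std_simplex_map f (vertex i) = vertex (f i).
Proof.
apply: bcoord_inj => j; rewrite bcoord_map bcoord_vertex.
have [->|/eqP ne] := eqVneq j (f i).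
  rewrite (bigD1 i) //= bcoord_vertex eqxx big1 ?addr0 // => k /andP[_ /negbTE ki].
  by rewrite bcoord_vertex ki.
rewrite big1 // => k /eqP fk; rewrite bcoord_vertex.
by case: eqP => // ki; case: ne; rewrite -fk ki.
Qed.

(* The junk value of [mk_simplex] outside the simplex is the vertex 0. *)
Definition mk_simplex n (v : 'I_n.+1 -> R) : simplex n :=
  insubd (vertex ord0) (\row_j v j).

Lemma bcoord_mk n (v : 'I_n.+1 -> R) j : (forall i, 0 <= v i) -> \sum_i v i = 1 ->
  bcoord (mk_simplex v) j = v j.
Proof.
move=> v0 v1; rewrite /bcoord /mk_simplex.
have vP : (\row_j v j) \in @std_simplex_set R n.
  apply/mem_set; split=> [i|]; first by rewrite mxE.
  by rewrite -[RHS]v1; apply: eq_bigr => i _; rewrite mxE.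
by rewrite [set_val _](insubdK _ vP) mxE.
Qed.

Lemma bcoord_continuous n j : continuous (fun t : simplex n => bcoord t j).
Proof.
move=> t; apply: (@continuous_comp _ _ _ set_val (fun M : 'rV[R]_n.+1 => M ord0 j)).
  exact: initial_continuous.
exact: coord_continuous.
Qed.

Lemma to_simplex_continuous (Z : topologicalType) n (F : Z -> simplex n) :
  (forall j, continuous (fun z => bcoord (F z) j)) -> continuous F.
Proof.
move=> Fc; apply: continuous_comp_initial => z B [P nP sPB].
have nPj (j : 'I_n.+1) : nbhs z [set s | P ord0 j (bcoord (F s) j)].
  by apply: (Fc j z); exact: nP.
have nPall := @filter_forall _ _ _ (nbhs z) (nbhs_filter z) nPj.
apply: (filterS _ nPall) => s sP.
by apply: sPB => i j /=; rewrite ord1; exact: sP.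
Qed.

Lemma simplex_nbhs n (t : simplex n) (U : set (simplex n)) : nbhs t U ->
  exists2 d : R, 0 < d & forall t', (forall j, `|bcoord t' j - bcoord t j| < d) -> U t'.
Proof.
move=> [_ [[O oO <-] Ot OU]].
have [P nP sPO] : nbhs (set_val t) O by exact: open_nbhs_nbhs.
have dP j : exists2 d : R, 0 < d & forall y, `|y - bcoord t j| < d -> P ord0 j y.
  have /nbhs_ballP[d /= d0 dP] := nP ord0 j.
  by exists d => // y yd; apply: dP; rewrite /= /ball /= distrC.
pose d j := s2val (cid2 (dP j)).
have d0 j : 0 < d j by rewrite /d; case: (cid2 _).
exists (\big[Order.min/1]_j d j).
  by elim/big_ind: _ => // x y x0 y0; rewrite lt_min x0.
move=> t' t'd; apply: OU; apply: sPO => i j /=; rewrite ord1.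
rewrite -/(bcoord t' j); have : `|bcoord t' j - bcoord t j| < d j.
  by apply: (lt_le_trans (t'd j)); exact: bigmin_le_cond.
by rewrite /d; case: (cid2 _) => /= ? _; apply.
Qed.

Lemma std_simplex_set_compact n : compact (@std_simplex_set R n).
Proof.
apply: (@subclosed_compact _ _
    [set v : 'rV[R]_n.+1 | forall i, `[0, 1]%classic (v ord0 i)]).
- have -> : @std_simplex_set R n =
      (\bigcap_(i in [set: 'I_n.+1]) [set v : 'rV[R]_n.+1 | 0 <= v ord0 i]) `&`
      [set v : 'rV[R]_n.+1 | \sum_i v ord0 i = 1].
    apply/seteqP; split=> [v [v0 v1]|v [v0 v1]].
      by split=> // i _; exact: v0.
    by split=> // i; exact: v0.
  apply: closedI; first apply: closed_bigI => i _.
    apply: (@preimage_closed _ _ (fun v : 'rV[R]_n.+1 => v ord0 i) [set x | 0 <= x]).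
      by move=> v _; exact: coord_continuous.
    exact: closed_ge.
  apply: (@preimage_closed _ _ (fun v : 'rV[R]_n.+1 => \sum_i v ord0 i)
    [set x | x = 1]).
    move=> v _; apply: (@continuous_big _ _ _ _ _ _ _ _ _) => [|i _ s].
      exact: add_continuous.
    exact: coord_continuous.
  exact: closed_eq.
- apply: (@rV_compact _ n.+1 (fun=> `[(0 : R), 1]%classic)) => i.
  exact: segment_compact.
- move=> v [v0 v1] i /=; rewrite in_itv /= v0 /= -v1 (bigD1 i) //= lerDl.
  by apply: sumr_ge0 => j _; exact: v0.
Qed.

(** Lebesgue number lemma, for the sup distance of barycentric coordinates. Around each point some
    radius d fits into one W i; then any e < d/2 serves all points within d/2, and compactness makes
    e uniform. *)
Lemma simplex_lebesgue n (I : Type) (W : I -> set (simplex n)) :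
  (forall i, open (W i)) -> (forall t, exists i, W i t) ->
  exists2 e : R, 0 < e & forall t, exists i, forall t',
    (forall j, `|bcoord t' j - bcoord t j| < e) -> W i t'.
Proof.
move=> oW cW.
(* P is a predicate on row vectors because compactness is available for the set of points in the
   ambient matrix space. *)
pose P (e : R) (v : 'rV[R]_n.+1) := forall t : simplex n, set_val t = v ->
  exists i, forall t', (forall j, `|bcoord t' j - bcoord t j| < e) -> W i t'.
have : \forall e \near 0^'+, @std_simplex_set R n `<=` P e.
  apply: (iffLR (compact_near_coveringP _) (@std_simplex_set_compact n)) => v Kv.
  pose t0 : simplex n := SigSub (mem_set Kv).
  have [i Wi] := cW t0.
  have [d d0 dW] := simplex_nbhs (open_nbhs_nbhs (conj (oW i) Wi)).
  have d20 : 0 < d / 2 by rewrite divr_gt0.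
  exists ([set x : 'rV[R]_n.+1 | forall i j, ball (v i j) (d / 2) (x i j)],
          [set e : R | e < d / 2]).
    split=> /=; last exact: nbhs_right_lt.
    by exists (fun k j => ball (v k j) (d / 2)) => // k j; exact: nbhsx_ballx.
  move=> [x e] /= [vx ed] t tx; exists i => t' tt'.
  apply: dW => j.
  have vxj : `|bcoord t j - bcoord t0 j| < d / 2.
    have := vx ord0 j; rewrite /ball /= distrC; rewrite /bcoord tx //.
  rewrite -[bcoord t' j](subrK (bcoord t j)) -addrA.
  apply: (le_lt_trans (ler_normD _ _)); rewrite [ltRHS](splitr d) ltrD //.
  exact: lt_trans (tt' j) ed.
move=> Pnear; near (0 : R)^'+ => e.
exists e => // t.
have : @std_simplex_set R n `<=` P e by near: e.
by apply; [exact: set_valP|].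
Unshelve. all: by end_near.
Qed.

End SimplexPoints.

(** * Iterated barycentric subdivision and its mesh *)

Section Barycenters.
Variable R : realType.
Local Notation simplex := (std_simplex R).

Definition bary n (w : seq (simplex n)) : simplex n :=
  mk_simplex (fun j => (\sum_(v <- w) bcoord v j) / (size w)%:R).

Lemma bcoord_bary n (w : seq (simplex n)) j : (0 < size w)%N ->
  bcoord (bary w) j = (\sum_(v <- w) bcoord v j) / (size w)%:R.
Proof.
move=> w0; rewrite bcoord_mk // => [i|].
  by rewrite divr_ge0 ?ler0n // sumr_ge0 // => v _; exact: bcoord_ge0.
rewrite -mulr_suml exchange_big /=.
under eq_bigr do rewrite bcoord_sum.
by rewrite big_const_seq count_predT iter_addr addr0 divff // pnatr_eq0 -lt0n.
Qed.

Lemma bary_map m n (f : 'I_m.+1 -> 'I_n.+1) (w : seq (simplex m)) :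
  (0 < size w)%N ->
  bary (map (std_simplex_map f) w) = std_simplex_map f (bary w).
Proof.
move=> w0; apply: bcoord_inj => j.
rewrite bcoord_bary ?size_map // bcoord_map big_map.
under eq_bigr do rewrite bcoord_map.
rewrite exchange_big mulr_suml; apply: eq_bigr => i _.
by rewrite bcoord_bary.
Qed.

Lemma bary_ball n (w : seq (simplex n)) j (c r : R) : (0 < size w)%N ->
  (forall u, u \in w -> `|bcoord u j - c| <= r) -> `|bcoord (bary w) j - c| <= r.
Proof.
move=> w0 wr; have sw : 0 < (size w)%:R :> R by rewrite ltr0n.
rewrite bcoord_bary //.
have -> : (\sum_(v <- w) bcoord v j) / (size w)%:R - c =
    (\sum_(v <- w) (bcoord v j - c)) / (size w)%:R.
  rewrite sumrB big_const_seq count_predT iter_addr addr0 mulrBl.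
  by rewrite -[c *+ _]mulr_natr mulfK // gt_eqF.
rewrite normrM normfV (gtr0_norm sw) ler_pdivrMr //.
apply: (le_trans (ler_norm_sum _ _ _)).
rewrite mulr_natr -[leRHS]addr0 -iter_addr -(count_predT w) -big_const_seq.
by rewrite !big_seq; apply: ler_sum => v vw; exact: wr.
Qed.

(** The term of u itself contributes 0 to the average, so only m of the m+1 terms count. *)
Lemma bary_near n m (w : seq (simplex n)) j (d : R) u : size w = m.+1 -> u \in w ->
  (forall v, v \in w -> `|bcoord v j - bcoord u j| <= d) ->
  `|bcoord (bary w) j - bcoord u j| <= m%:R / m.+1%:R * d.
Proof.
move=> sw uw wd; have m0 : 0 < m.+1%:R :> R by rewrite ltr0n.
rewrite bcoord_bary ?sw //.
have -> : (\sum_(v <- w) bcoord v j) / m.+1%:R - bcoord u j =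
    (\sum_(v <- w) (bcoord v j - bcoord u j)) / m.+1%:R.
  rewrite sumrB big_const_seq count_predT iter_addr addr0 mulrBl sw.
  by rewrite -[bcoord u j *+ _]mulr_natr mulfK // gt_eqF.
rewrite normrM normfV (gtr0_norm m0) mulrAC ler_pM2r ?invr_gt0 //.
rewrite (perm_big _ (perm_to_rem uw)) /= big_cons subrr add0r.
apply: (le_trans (ler_norm_sum _ _ _)).
have sr : size (rem u w) = m by rewrite size_rem // sw.
rewrite mulrC mulr_natr -[leRHS]addr0 -iter_addr -[X in iter X]sr.
rewrite -(count_predT (rem u w)) -big_const_seq !big_seq.
by apply: ler_sum => v /mem_rem vw; exact: wd.
Qed.

Definition mesh n (d : R) (w : seq (simplex n)) :=
  forall u v, u \in w -> v \in w -> forall j, `|bcoord u j - bcoord v j| <= d.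

Lemma sdsupp_ball n m (w l : seq (simplex n)) v j (c r : R) :
  sdsupp (@bary n) m w l -> size w = m.+1 -> v \in l ->
  (forall u, u \in w -> `|bcoord u j - c| <= r) -> `|bcoord v j - c| <= r.
Proof.
elim: m w l => [|m IH] w l /=.
  by move=> -> sw; rewrite inE => /eqP -> wr; apply: bary_ball; rewrite ?sw.
move=> [i [l' [iw -> wl']]] sw; rewrite inE => /orP[/eqP ->|vl'] wr.
  by apply: bary_ball; rewrite ?sw.
apply: IH wl' _ vl' _; first by rewrite size_del // sw.
by move=> u /mem_del; exact: wr.
Qed.

Lemma ratio_le m : m%:R / m.+1%:R <= m.+1%:R / m.+2%:R :> R.
Proof.
rewrite ler_pdivrMr ?ltr0n // mulrAC ler_pdivlMr ?ltr0n // -!natrM ler_nat.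
by nia.
Qed.

(** Two vertices of l either both lie in the subdivision of a face, where the smaller ratio of the
    induction applies, or one is the barycenter of w. In that case the other is a convex combination
    of vertices of w, all of which [bary_near] puts close to the barycenter. *)
Lemma sdsupp_mesh n m (w l : seq (simplex n)) (d : R) :
  sdsupp (@bary n) m w l -> size w = m.+1 -> 0 <= d -> mesh d w ->
  mesh (m%:R / m.+1%:R * d) l.
Proof.
elim: m w l => [|m IH] w l wl sw d0 wd.
  have /= -> := wl; move=> u v; rewrite !inE => /eqP -> /eqP -> j.
  by rewrite subrr normr0 !mul0r.
have [i [l' [iw -> wl']]] := wl.
have sdw : size (del i w) = m.+1 by rewrite size_del // sw.
have dw u v : u \in del i w -> v \in del i w -> forall j, `|bcoord u j - bcoord v j| <= d.
  by move=> /mem_del uw /mem_del vw; exact: wd.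
have far v : v \in l' -> forall j,
    `|bcoord v j - bcoord (bary w) j| <= m.+1%:R / m.+2%:R * d.
  move=> vl j; apply: (sdsupp_ball wl' sdw vl) => u /mem_del uw.
  by rewrite distrC; apply: bary_near => // x xw; exact: wd.
move=> u v; rewrite !inE => /orP[/eqP ->|ul] /orP[/eqP ->|vl] j.
- by rewrite subrr normr0 mulr_ge0 // divr_ge0 ?ler0n.
- by rewrite distrC; exact: far.
- exact: far.
- apply: (le_trans (IH _ _ wl' sdw d0 dw u v ul vl j)).
  by apply: ler_wpM2r => //; exact: ratio_le.
Qed.

Section Iterated.
Variable B : zmodType.

Fixpoint sdk k n m (w : seq (simplex n)) (f : seq (simplex n) -> B) : B :=
  if k is k'.+1 then sdg (@bary n) m w (fun v => sdk k' m v f) else f w.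

Fixpoint sdksupp k n m (w l : seq (simplex n)) : Prop :=
  if k is k'.+1 then exists2 v, sdsupp (@bary n) m w v & sdksupp k' m v l
  else l = w.

Lemma eq_sdk k n m (w : seq (simplex n)) f g :
  (forall l, sdksupp k m w l -> f l = g l) -> sdk k m w f = sdk k m w g.
Proof.
elim: k w => [|k IH] w fg /=; first exact: fg.
by apply: eq_sdg => v wv; apply: IH => l vl; apply: fg; exists v.
Qed.

Lemma sdkB k n m (w : seq (simplex n)) f g :
  sdk k m w (fun l => f l - g l) = sdk k m w f - sdk k m w g.
Proof.
elim: k w => [|k IH] w //=; rewrite -sdgB.
by apply: eq_sdg => v _.
Qed.

Lemma sdk_cobd k n m (w : seq (simplex n)) f : size w = m.+2 ->
  cobd (fun v => sdk k m v f) w = sdk k m.+1 w (cobd f).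
Proof.
elim: k w => [|k IH] w sw //; rewrite [LHS]sdg_cobd //.
by apply: eq_sdg => v wv; apply: IH; rewrite (size_sdsupp wv).
Qed.

Lemma sdk_map k n p m (h : 'I_n.+1 -> 'I_p.+1) (w : seq (simplex n)) f :
  size w = m.+1 ->
  sdk k m (map (std_simplex_map h) w) f =
  sdk k m w (fun l => f (map (std_simplex_map h) l)).
Proof.
elim: k w => [//|k IH] w sw.
rewrite [LHS](sdg_map (a := @bary n) (h' := std_simplex_map h)) //; last first.
  by move=> v; exact: bary_map.
by apply: eq_sdg => v wv; apply: IH; rewrite (size_sdsupp wv).
Qed.

End Iterated.

Lemma size_sdksupp k n m (w l : seq (simplex n)) :
  sdksupp k m w l -> size w = m.+1 -> size l = m.+1.
Proof.
elim: k w => [|k IH] w /=; first by move=> ->.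
by move=> [v wv vl] _; apply: IH vl _; exact: size_sdsupp wv.
Qed.

Lemma sdksupp_mesh k n m (w l : seq (simplex n)) (d : R) :
  sdksupp k m w l -> size w = m.+1 -> 0 <= d -> mesh d w ->
  mesh ((m%:R / m.+1%:R) ^+ k * d) l.
Proof.
elim: k w d => [|k IH] w d /=; first by move=> -> _ _; rewrite expr0 mul1r.
move=> [v wv vl] sw d0 wd; rewrite exprSr -mulrA; apply: IH vl _ _ _.
- exact: size_sdsupp wv.
- by rewrite mulr_ge0 // divr_ge0 ?ler0n.
- exact: sdsupp_mesh wv sw d0 wd.
Qed.

Definition vertices n : seq (simplex n) := [seq vertex R i | i <- enum 'I_n.+1].

Lemma size_vertices n : size (vertices n) = n.+1.
Proof. by rewrite size_map size_enum_ord. Qed.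

Lemma del_vertices n (i : 'I_n.+2) :
  del i (vertices n.+1) = map (std_simplex_map (lift i)) (vertices n).
Proof.
have si : (i < size (vertices n.+1))%N by rewrite size_vertices.
have ss : size (del i (vertices n.+1)) = n.+1 by rewrite size_del // size_vertices.
apply: (@eq_from_nth _ (vertex R ord0)).
  by rewrite ss size_map size_vertices.
move=> k; rewrite ss => kn; rewrite nth_del /vertices -map_comp.
have bk : (bump i k < n.+2)%N by rewrite /bump; lia.
rewrite (nth_map ord0) ?size_enum_ord // (nth_map ord0) ?size_enum_ord //=.
rewrite vertex_map; congr vertex; apply: ord_inj => /=.
by rewrite nth_enum_ord // nth_enum_ord.
Qed.

(** The initial mesh is at most 1 and each subdivision multiplies the bound by n/(n+1). The bound is
    needed for all large k, since one k will have to serve many simplices. *)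
Lemma mesh_vertices_small n (e : R) : 0 < e -> exists k0, forall k, (k0 <= k)%N ->
  forall l, sdksupp k n (vertices n) l ->
  forall u v, u \in l -> v \in l -> forall j, `|bcoord u j - bcoord v j| < e.
Proof.
move=> e0; set q : R := n%:R / n.+1%:R.
have q0 : 0 <= q by rewrite divr_ge0 ?ler0n.
have q1 : `|q| < 1.
  by rewrite ger0_norm // ltr_pdivrMr ?ltr0n // mul1r ltr_nat.
have /(_ [set x | x < e]) [] := cvg_expr q1.
  by apply: (@open_nbhs_nbhs _ (0 : R)); split=> //; exact: open_lt.
move=> k0 _ k0q; exists k0 => k kk l wl u v ul vl j.
have m1 : mesh 1 (vertices n).
  move=> x y _ _ i; have := bcoord_ge0 x i; have := bcoord_ge0 y i.
  by have := bcoord_le1 x i; have := bcoord_le1 y i; rewrite ler_norml; lra.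
have := sdksupp_mesh wl (size_vertices n) ler01 m1 ul vl j.
rewrite mulr1 => /le_lt_trans; apply; exact: k0q.
Qed.

End Barycenters.

(** * Barycentric coordinates on the realization *)

Section Realization.
Variables (R : realType) (G : groupType).
Local Notation simplex := (std_simplex R).
Local Notation Y := (E3 R G).

Lemma affinely_nil2P n (x : 'I_n.+1 -> G) : affinely_nil2 x <-> nil2 (codom x).
Proof.
split=> -[y [H [sH nH xH]]]; exists y, H; split=> //.
  by move=> g /codomP[i ->].
by move=> i; apply: xH; exact: codom_f.
Qed.

Lemma affinely_nil2_pull m n (x : 'I_n.+1 -> G) (f : 'I_m.+1 -> 'I_n.+1) :
  affinely_nil2 x -> affinely_nil2 (x \o f).
Proof. by move=> [y [H [sH nH xH]]]; exists y, H; split=> // i; exact: xH. Qed.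

Lemma affinely_nil2_const n g : affinely_nil2 (fun _ : 'I_n.+1 => g : G).
Proof.
exists g, [set 1%g]; split; first exact: trivial_subgroup.
  apply/nilpotent2P; first exact: trivial_subgroup.
  by move=> a b c -> -> ->; rewrite !commgg.
by move=> i; rewrite mulVg.
Qed.

Definition cell_point n (x : E3_simplex G n) (t : simplex n) : Y :=
  \pi_Y (cell (X := E3_sset G) x t).

Lemma glue_point p q : glue (R := R) (X := E3_sset G) p q -> \pi_Y p = \pi_Y q.
Proof. by move=> pq; apply/eqquotP/asboolP/rst_step. Qed.

Lemma cell_point_face n (i : 'I_n.+2) (x : E3_simplex G n.+1) t :
  cell_point (E3_pull (lift i) x) t = cell_point x (std_simplex_map (lift i) t).
Proof. exact: glue_point (glue_face i (x : E3_sset G n.+1) t). Qed.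

Lemma cell_point_degen n (i : 'I_n.+1) (x : E3_simplex G n) t :
  cell_point (E3_pull (codegen i) x) t = cell_point x (std_simplex_map (codegen i) t).
Proof. exact: glue_point (glue_degen i (x : E3_sset G n) t). Qed.

Lemma cell_point_surj (p : Y) : exists n (x : E3_simplex G n) t, p = cell_point x t.
Proof.
have := reprK p; case: (repr p) => -[n x] t <-; by exists n, x, t.
Qed.

Lemma cell_point_continuous n (x : E3_simplex G n) : continuous (cell_point x).
Proof.
move=> t; apply: (@continuous_comp _ _ _ (cell (X := E3_sset G) x) (\pi_Y)).
  exact: existT_continuous.
exact: pi_continuous.
Qed.

Lemma E3_continuous (Z : topologicalType) (f : Y -> Z) :
  (forall n (x : E3_simplex G n), continuous (fun t => f (cell_point x t))) ->
  continuous f.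
Proof.
move=> fc; apply/quotient_continuous.
move=> [[n x] t] U nU.
apply: (@existT_continuous _ (fun x : {n : nat & E3_sset G n} =>
  std_simplex R (tag x)) (existT _ n x) t).
exact: (fc n x t).
Qed.

Section Descent.
Variables (Z : Type) (F : forall n, E3_simplex G n -> simplex n -> Z).
Hypothesis F_face : forall n (i : 'I_n.+2) (x : E3_simplex G n.+1) t,
  F (E3_pull (lift i) x) t = F x (std_simplex_map (lift i) t).
Hypothesis F_degen : forall n (i : 'I_n.+1) (x : E3_simplex G n) t,
  F (E3_pull (codegen i) x) t = F x (std_simplex_map (codegen i) t).

Let F' (q : presentation R (E3_sset G)) : Z := F (tagged (tag q)) (tagged q).

Definition descend (p : Y) : Z := F' (repr p).

Lemma descendE n (x : E3_simplex G n) t : descend (cell_point x t) = F x t.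
Proof.
rewrite /descend; set q := cell (X := E3_sset G) x t.
have : \pi_Y (repr (\pi_Y q)) = \pi_Y q by rewrite reprK.
move=> /eqquotP/asboolP; rewrite -[RHS]/(F' q).
elim=> {q} //= [p q [m i y s|m i y s]|p q r _ -> _ ->] //.
- exact: F_face.
- exact: F_degen.
Qed.

End Descent.

(** The barycentric coordinate at the vertex g; a sum, because g may occur several times among the
    vertices of a cell. *)
Definition lam (g : G) : Y -> R := descend
  (fun n (x : E3_simplex G n) (t : simplex n) =>
    \sum_(i | set_val x i == g) bcoord t i).

Local Lemma lam_compat m n (f : 'I_m.+1 -> 'I_n.+1) (x : E3_simplex G n) g
    (t : simplex m) :
  \sum_(i | set_val (E3_pull f x) i == g) bcoord t i =
  \sum_(i | set_val x i == g) bcoord (std_simplex_map f t) i.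
Proof.
under [RHS]eq_bigr do rewrite bcoord_map.
rewrite (partition_big f (fun i => set_val x i == g)) //=.
apply: eq_bigr => j xj; apply: eq_bigl => i.
apply/andP/eqP => [[_ /eqP]//|fij]; split; last exact/eqP.
by have -> : set_val (E3_pull f x) i = set_val x j by rewrite -fij.
Qed.

Lemma lam_cell g n (x : E3_simplex G n) t :
  lam g (cell_point x t) = \sum_(i | set_val x i == g) bcoord t i.
Proof. by apply: descendE => *; exact: lam_compat. Qed.

Lemma lam_continuous g : continuous (lam g).
Proof.
apply: E3_continuous => n x.
have -> : (fun t => lam g (cell_point x t)) =
    (fun t => \sum_(i | set_val x i == g) bcoord t i).
  by apply/funext => t; exact: lam_cell.
move=> t; apply: (@continuous_big _ _ _ _ _ _ _ _ _) => [|i _ s].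
  exact: add_continuous.
exact: bcoord_continuous.
Qed.

Lemma lam_ge0 g p : 0 <= lam g p.
Proof.
have [n [x [t ->]]] := cell_point_surj p; rewrite lam_cell.
by apply: sumr_ge0 => i _; exact: bcoord_ge0.
Qed.

Lemma lam_gt0_mem g n (x : E3_simplex G n) t :
  0 < lam g (cell_point x t) -> g \in codom (set_val x).
Proof.
rewrite lam_cell; apply: contraTT => gx; rewrite big_pred0 ?ltxx // => i.
by apply: contraNF gx => /eqP <-; exact: codom_f.
Qed.

Lemma lam_gt0_coord n (x : E3_simplex G n) t i :
  0 < bcoord t i -> 0 < lam (set_val x i) (cell_point x t).
Proof.
move=> ti; rewrite lam_cell (bigD1 i) //=; apply: ltr_wpDr => //.
by apply: sumr_ge0 => j _; exact: bcoord_ge0.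
Qed.

(** 1/(n+1) is the average of the coordinates. *)
Lemma bcoord_large n (t : simplex n) : exists i, n.+1%:R^-1 <= bcoord t i.
Proof.
apply: contrapT => /forallNP small; have := bcoord_sum t; apply/eqP.
rewrite lt_eqF //; have -> : 1 = \sum_(i < n.+1) (n.+1%:R^-1 : R).
  by rewrite sumr_const card_ord -[_ *+ _]mulr_natr mulVf // pnatr_eq0.
apply: ltr_sum => [|i _]; last by rewrite ltNge; apply/negP; exact: small.
by apply/hasP; exists ord0; rewrite ?mem_index_enum.
Qed.

Lemma lam_cover p : exists g, 0 < lam g p.
Proof.
have [n [x [t ->]]] := cell_point_surj p.
have [i ti] := bcoord_large t; exists (set_val x i); apply: lam_gt0_coord.
by apply: lt_le_trans ti; rewrite invr_gt0 ltr0n.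
Qed.

(** All these g are vertices of any one cell containing p. *)
Lemma lam_gt0_nil2 p l : (forall g, g \in l -> 0 < lam g p) -> nil2 l.
Proof.
have [n [x [t ->]]] := cell_point_surj p => lp.
apply: (@nil2_sub _ _ (codom (set_val x))).
  by move=> g gl; apply: lam_gt0_mem (lp g gl).
by apply/affinely_nil2P; exact: (set_valP x).
Qed.

(** The product of a quotient map with R needs local compactness of R to be a quotient map.
    Concretely, W' contains the image of a closed interval around s0 at p0, and U collects the
    points for which the whole interval lands in W'. *)
Lemma E3_htpy_continuous (Z : topologicalType) (h : R -> Y -> Z) :
  (forall n (x : E3_simplex G n),
     continuous (fun st : R * simplex n => h st.1 (cell_point x st.2))) ->
  continuous (fun sp : R * Y => h sp.1 sp.2).
Proof.
move=> hc [s0 p0] W; rewrite nbhsE /= => -[W' [oW Ws0] W'W].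
have [n0 [x0 [t0 p0E]]] := cell_point_surj p0.
have [e e0 eW] : exists2 e : R, 0 < e &
    forall s, s0 - e <= s <= s0 + e -> W' (h s p0).
  have /= := hc n0 x0 (s0, t0) W'.
  rewrite -p0E => /(_ (open_nbhs_nbhs (conj oW Ws0))) -[[P Q] /= [nP nQ] PQ].
  have /nbhs_ballP[d /= d0 dP] := nP.
  exists (d / 2); first by rewrite divr_gt0.
  move=> s /andP[s1 s2]; rewrite p0E; apply: (PQ (s, t0)); split=> /=.
    by apply: dP; rewrite /ball /= ltr_norml; lra.
  exact: nbhs_singleton.
pose K : set R := `[s0 - e, s0 + e]%classic.
pose U : set Y := [set p | forall s, K s -> W' (h s p)].
have oU : open U.
  suff : open ((\pi_Y : presentation R (E3_sset G) -> Y) @^-1` U) by [].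
  apply: (iffRL (@sigT_openP _ (fun x : {n : nat & E3_sset G n} =>
    std_simplex R (tag x)) _)) => -[n x].
  rewrite openE => t /= Ut.
  (* Tube lemma: compactness of the interval makes the preimage of U in each cell open. *)
  have := iffLR (compact_near_coveringP _) (@segment_compact R (s0 - e) (s0 + e)).
  move=> /(_ _ (nbhs t) (fun t' s => W' (h s (cell_point x t'))) _); apply => s Ks.
  apply: (hc n x (s, t) W'); apply: open_nbhs_nbhs; split=> //.
  exact: Ut.
exists ([set s | K s], U).
  split=> /=; last first.
    have Up0 : U p0.
      by move=> s Ks; apply: eW; move: Ks; rewrite /K /= in_itv.
    exact: (@open_nbhs_nbhs Y p0 U (conj oU Up0)).
  apply/nbhs_ballP; exists e => //= s se.
  by move: se; rewrite /K /ball /= in_itv /= ltr_norml; lra.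
by move=> [s p] /= [Ks Up]; apply: W'W; exact: Up.
Qed.

End Realization.

(** * Evaluating cochains on singular simplices *)

Section Cells.
Variables (R : realType) (G : groupType).
Local Notation simplex := (std_simplex R).
Local Notation Y := (E3 R G).

Definition base_point : Y :=
  cell_point (SigSub (mem_set (affinely_nil2_const 0 (1%g : G)))) (vertex R ord0).

(* [cellf x] is constant, with a junk value, if x is not affinely nil-2. *)
Definition cellf n (x : 'I_n.+1 -> G) (t : simplex n) : Y :=
  if pselect (affinely_nil2 x) is left nx then cell_point (SigSub (mem_set nx)) t
  else base_point.

Lemma cellfE n (x : E3_simplex G n) t : cellf (set_val x) t = cell_point x t.
Proof.
rewrite /cellf; case: pselect => [nx|]; last by case; exact: (set_valP x).
by congr cell_point; apply: val_inj.
Qed.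

Lemma cellf_face n (i : 'I_n.+2) (x : 'I_n.+2 -> G) t : affinely_nil2 x ->
  cellf (x \o lift i) t = cellf x (std_simplex_map (lift i) t).
Proof.
move=> nx; pose x' : E3_simplex G n.+1 := SigSub (mem_set nx).
rewrite -[x \o _]/(set_val (E3_pull (lift i) x')) -[x]/(set_val x').
by rewrite !cellfE cell_point_face.
Qed.

Lemma cellf_degen n (i : 'I_n.+1) (x : 'I_n.+1 -> G) t : affinely_nil2 x ->
  cellf (x \o codegen i) t = cellf x (std_simplex_map (codegen i) t).
Proof.
move=> nx; pose x' : E3_simplex G n := SigSub (mem_set nx).
rewrite -[x \o _]/(set_val (E3_pull (codegen i) x')) -[x]/(set_val x').
by rewrite !cellfE cell_point_degen.
Qed.

Lemma cellf_continuous n (x : 'I_n.+1 -> G) : continuous (cellf x).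
Proof.
rewrite /cellf; case: pselect => nx; first exact: cell_point_continuous.
exact: cst_continuous.
Qed.

(** The gluing relation knows only single cofaces, so the inclusion of an initial segment is
    factored into d omissions of the last vertex. *)
Lemma cellf_widen m d (x : 'I_(d + m).+1 -> G) (f : 'I_m.+1 -> 'I_(d + m).+1) t :
  (forall i, f i = i :> nat) -> affinely_nil2 x ->
  cellf (x \o f) t = cellf x (std_simplex_map f t).
Proof.
elim: d x f => [|d IH] x f fE nx.
  have -> : f = id by apply/funext => i; exact: ord_inj.
  by rewrite std_simplex_map_id.
have ltf (i : 'I_m.+1) : (i < (d + m).+1)%N.
  by apply: leq_trans (ltn_ord i) _; rewrite ltnS leq_addl.
pose f' i := Ordinal (ltf i).
have -> : f = lift ord_max \o f'.
  apply/funext => i; apply: ord_inj; rewrite fE /= /bump.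
  by have := ltf i; lia.
rewrite -std_simplex_map_comp -cellf_face //.
by rewrite -(IH (x \o lift ord_max) f') //; exact: affinely_nil2_pull.
Qed.

Lemma cellf_initial m n (x : 'I_n.+1 -> G) (f : 'I_m.+1 -> 'I_n.+1) t :
  (forall i, f i = i :> nat) -> affinely_nil2 x ->
  cellf (x \o f) t = cellf x (std_simplex_map f t).
Proof.
move=> fE; have mn : (m <= n)%N by have := ltn_ord (f ord_max); rewrite fE.
by move: x f fE; rewrite -(subnK mn) => x f; exact: cellf_widen.
Qed.

Definition sing_cell n (x : 'I_n.+1 -> G) : singular_simplex R Y n :=
  mkcts (@cellf_continuous n x).

Lemma sing_cell_face n (i : 'I_n.+2) (x : 'I_n.+2 -> G) : affinely_nil2 x ->
  singular_face i (sing_cell x) = sing_cell (x \o lift i).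
Proof.
by move=> nx; apply/continuousEP => t; rewrite -[RHS]/(cellf (x \o lift i) t) cellf_face.
Qed.

Definition ltup n (l : seq G) (i : 'I_n.+1) : G := nth 1%g l i.

Lemma ltup_nil2 n l : size l = n.+1 -> nil2 l -> affinely_nil2 (@ltup n l).
Proof.
move=> sl nl; apply/affinely_nil2P; apply: nil2_sub nl => g /codomP[i ->].
by rewrite mem_nth // sl.
Qed.

Lemma ltup_del n l (i : 'I_n.+2) : @ltup n (del i l) = @ltup n.+1 l \o lift i.
Proof. by apply/funext => j; rewrite /ltup nth_del. Qed.

Lemma sing_face_ltup n l (i : 'I_n.+2) : size l = n.+2 -> nil2 l ->
  singular_face i (sing_cell (@ltup n.+1 l)) = sing_cell (@ltup n (del i l)).
Proof. by move=> sl nl; rewrite sing_cell_face ?ltup_del //; exact: ltup_nil2. Qed.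

End Cells.

Section Evaluation.
Variables (R : realType) (G : groupType) (B : zmodType).
Local Notation simplex := (std_simplex R).
Local Notation Y := (E3 R G).
Implicit Types f : seq G -> B.

(** A label g whose open star contains all of l, with junk value 1 if there is none; it plays the
    role of the barycenter in [sdg]. *)
Definition apex (l : seq Y) : G :=
  xget 1%g [set g | forall p, p \in l -> 0 < lam g p].

Definition star_small (w : seq Y) := exists g, forall p, p \in w -> 0 < lam g p.

Lemma apexP w : star_small w -> forall p, p \in w -> 0 < lam (apex w) p.
Proof.
move=> wg; exact: (@xgetPex _ 1%g [set g | forall p, p \in w -> 0 < lam g p] wg).
Qed.

(** The labels in l belong to a flag of faces of w, and a vertex p of the smallest face lies in all
    of them. *)
Lemma apex_supp n w l : sdsupp apex n w l -> size w = n.+1 -> star_small w ->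
  exists2 p, p \in w & forall g, g \in l -> 0 < lam g p.
Proof.
elim: n w l => [|n IH] w l /=.
  move=> -> sw ws; case: w sw ws => // p w _ ws.
  exists p; first exact: mem_head.
  by move=> g; rewrite inE => /eqP ->; apply: apexP => //; exact: mem_head.
move=> [i [l' [iw -> wl']]] sw ws.
have [||p pw pl] := IH _ _ wl'; first by rewrite size_del // sw.
  by have [g gw] := ws; exists g => p /mem_del; exact: gw.
exists p; first exact: mem_del pw.
move=> g; rewrite inE => /orP[/eqP ->|/pl//].
by apply: apexP => //; exact: mem_del pw.
Qed.

(** The value of f on the simplicial approximation of s: k geometric subdivisions, then one
    combinatorial subdivision labelled by [apex]. *)
Definition evk k n (s : singular_simplex R Y n) f : B :=
  sdk k n (vertices R n) (fun w => sdg apex n (map s w) f).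

Lemma evkB k n (s : singular_simplex R Y n) f g :
  evk k s (fun l => f l - g l) = evk k s f - evk k s g.
Proof. by rewrite /evk -sdkB; apply: eq_sdk => w _; rewrite sdgB. Qed.

Lemma evk0 k n (s : singular_simplex R Y n) : evk k s (fun=> 0) = 0.
Proof. by have := evkB k s (fun=> 0) (fun=> 0); rewrite !subrr. Qed.

(** Valid for every k, since [apex] is total; k has to be large only to control which lists
    occur. *)
Lemma evk_cobd k n (s : singular_simplex R Y n.+1) f :
  \sum_(i < n.+2) evk k (singular_face i s) f *~ (-1) ^+ i = evk k s (cobd f).
Proof.
pose phi w := sdg apex n (map s w) f.
transitivity (cobd (fun v => sdk k n v phi) (vertices R n.+1)).
  rewrite /cobd size_vertices; apply: eq_bigr => i _; congr (_ *~ _).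
  rewrite del_vertices sdk_map ?size_vertices //.
  by apply: eq_sdk => w _; rewrite /phi -map_comp.
rewrite sdk_cobd ?size_vertices //; apply: eq_sdk => w ww.
rewrite -sdg_cobd ?cobd_map //.
by rewrite size_map (size_sdksupp ww) // size_vertices.
Qed.

Lemma eq_evk_star k n (s : singular_simplex R Y n) f g :
  (forall w, sdksupp k n (vertices R n) w -> star_small (map s w)) ->
  (forall l t, size l = n.+1 -> (forall g, g \in l -> 0 < lam g (s t)) -> f l = g l) ->
  evk k s f = evk k s g.
Proof.
move=> small fg; apply: eq_sdk => w ww; apply: eq_sdg => l wl.
have sw : size (map s w) = n.+1.
  by rewrite size_map (size_sdksupp ww) // size_vertices.
have [_ /mapP[t tw ->] tl] := apex_supp wl sw (small w ww).
by apply: (fg l t) => //; exact: size_sdsupp wl.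
Qed.

(** Beyond the Lebesgue number of the cover of s by open stars, every label list is positive at a
    common point and hence a simplex. The threshold depends on s. *)
Lemma eq_evk n (s : singular_simplex R Y n) : exists k0, forall k, (k0 <= k)%N ->
  forall f g, (forall l, size l = n.+1 -> nil2 l -> f l = g l) ->
  evk k s f = evk k s g.
Proof.
have [e e0 eW] : exists2 e : R, 0 < e & forall t, exists g, forall t',
    (forall j, `|bcoord t' j - bcoord t j| < e) -> 0 < lam g (s t').
  apply: (@simplex_lebesgue R n G (fun g => [set t | 0 < lam g (s t)])) => [g|t].
    apply: (@open_comp _ _ (lam g \o s) [set x | 0 < x]); last exact: open_gt.
    move=> t _; apply: continuous_comp; first exact: cts_fun.
    exact: lam_continuous.
  exact: lam_cover.
have [k0 k0P] := mesh_vertices_small n e0; exists k0 => k kk f g fg.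
apply: eq_evk_star => [w ww|l t sl lt]; last first.
  by apply: fg => //; exact: lam_gt0_nil2 lt.
have sw := size_sdksupp ww (size_vertices R n).
case: w ww sw => // u w ww _; have [h gP] := eW u; exists h => _ /mapP[v vw ->].
by apply: gP => j; apply: k0P ww _ _ _ _ _; rewrite ?mem_head.
Qed.

(** For cells the threshold depends on n only: a coordinate that is at least 1/(n+1) at one vertex
    of a small simplex stays positive at the others. The labels are then vertices of the cell, which
    is the carrier condition. *)
Lemma eq_evk_cell n : exists k0, forall k, (k0 <= k)%N ->
  forall (x : 'I_n.+1 -> G) f g, affinely_nil2 x ->
  (forall l, size l = n.+1 -> {subset l <= codom x} -> f l = g l) ->
  evk k (sing_cell R x) f = evk k (sing_cell R x) g.
Proof.
have e0 : 0 < n.+1%:R^-1 :> R by rewrite invr_gt0 ltr0n.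
have [k0 k0P] := mesh_vertices_small n e0; exists k0 => k kk x f g nx fg.
pose x' : E3_simplex G n := SigSub (mem_set nx).
have xE t : sing_cell R x t = cell_point x' t by exact: (cellfE x' t).
apply: eq_evk_star => [w ww|l t sl lt]; last first.
  apply: fg => // h hl; apply: (@lam_gt0_mem R G h n x' t).
  by rewrite -xE; exact: lt.
have sw := size_sdksupp ww (size_vertices R n).
case: w ww sw => // u w ww _; have [i ui] := bcoord_large u.
exists (x i) => _ /mapP[v vw ->]; rewrite xE; apply: (@lam_gt0_coord R G n x').
have := k0P k kk _ ww u v (mem_head _ _) vw i.
rewrite ltr_norml => /andP[_ /lt_le_trans/(_ ui)].
by rewrite ltrBlDr ltrDl.
Qed.

End Evaluation.

Section ZmodAction.
Variables (e : nat) (B : zmodType).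

(** For e > 0 this is additive in the residue only on elements b killed by e. *)
Definition zact : Zmod e -> B -> B :=
  match e return Zmod e -> B -> B with
  | 0 => fun z b => b *~ (z : int)
  | k.+1 => fun z b => b *+ (z : 'I_k.+1)
  end.

(** The class of 1; reducing 1 modulo e matters for e = 1, where it is 0. *)
Definition zone : Zmod e :=
  match e return Zmod e with
  | 0 => 1 : int
  | k.+1 => inord (1 %% k.+1) : 'I_k.+1
  end.

Lemma mulrn_mod (b : B) m p : b *+ p = 0 -> b *+ (m %% p) = b *+ m.
Proof.
by move=> bp; rewrite [in RHS](divn_eq m p) mulrnDr mulnC mulrnA bp mul0rn add0r.
Qed.

Lemma zactDl (b : B) : b *+ e = 0 -> {morph (zact^~ b) : x y / x + y}.
Proof.
rewrite /zact; case: e => [_ x y|k bk x y /=]; first by rewrite mulrzDr.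
by rewrite mulrn_mod // mulrnDr.
Qed.

Lemma zact1 (b : B) : b *+ e = 0 -> zact zone b = b.
Proof.
rewrite /zact /zone; case: e => [_|k bk]; first by rewrite mulr1z.
by rewrite inordK ?ltn_mod // mulrn_mod // mulr1n.
Qed.

Lemma zactDr x : {morph (zact x) : a b / a + b}.
Proof.
by rewrite /zact; case: e x => [|k] x a b; rewrite ?mulrzDl ?mulrnDl.
Qed.

Lemma zactr0 x : zact x 0 = 0.
Proof. by apply: (addrI (zact x 0)); rewrite -zactDr !addr0. Qed.

End ZmodAction.

(** * Cocycles detect boundaries of missing simplices *)

Section Detection.
Variables (R : realType) (G : groupType) (B : zmodType).
Local Notation Y := (E3 R G).

Lemma cobd_additive (T : Type) (B' : zmodType) (h : B -> B') (f : seq T -> B) l :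
  {morph h : x y / x + y} -> cobd (fun l => h (f l)) l = h (cobd f l).
Proof.
move=> hD; have h0 : h 0 = 0 by apply: (addrI (h 0)); rewrite -hD !addr0.
have hN x : h (- x) = - h x by apply: (addrI (h x)); rewrite -hD !subrr.
elim: l f => [|x l IH] f; first by rewrite !cobd_nil.
by rewrite !cobd_cons hD hN IH.
Qed.

Lemma evkD k n (s : singular_simplex R Y n) (f g : seq G -> B) :
  evk k s (fun l => f l + g l) = evk k s f + evk k s g.
Proof.
apply/eqP; rewrite -subr_eq -evkB; apply/eqP; congr evk.
by apply/funext => l; rewrite addrK.
Qed.

Definition ell k (v : seq G) (f : seq G -> B) : B :=
  evk k (sing_cell R (@ltup G (size v).-1 v)) f.

Lemma ellE k n v f : size v = n.+1 -> ell k v f = evk k (sing_cell R (@ltup G n v)) f.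
Proof. by move=> sv; rewrite /ell sv. Qed.

(** Comparison of the singular and the simplicial value of a cocycle on the sphere bd X, by acyclic
    carriers. *)
Lemma ell_sphere N : exists k0, forall k, (k0 <= k)%N -> forall X (f : seq G -> B),
  size X = N.+2 -> (forall i, (i < N.+2)%N -> nil2 (del i X)) ->
  (forall l, size l = N.+2 -> nil2 l -> cobd f l = 0) ->
  cobd (fun v => ell k v f) X = cobd f X.
Proof.
pose K n := sval (cid (@eq_evk_cell R G B n)).
have KP n : forall k, (K n <= k)%N ->
    forall (x : 'I_n.+1 -> G) (f g : seq G -> B), affinely_nil2 x ->
    (forall l, size l = n.+1 -> {subset l <= codom x} -> f l = g l) ->
    evk k (sing_cell R x) f = evk k (sing_cell R x) g.
  by rewrite /K; case: (cid _).
exists (\max_(n < N.+1) K n) => k kK X f sX nX f0.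
(* The bound on the length leaves finitely many dimensions, so the maximum of the thresholds is a
   single k0 valid for all X. *)
pose E (v : seq G) := nil2 v /\ (size v <= N.+1)%N.
apply: (@ell_cobd_sphere G B E (ell k)); rewrite ?sX //.
- move=> i x [nx sx]; split; first by apply: nil2_sub nx; exact: mem_del.
  have [ix|xi] := ltnP i (size x); first by rewrite size_del // (leq_trans (leq_pred _)).
  by rewrite /del drop_oversize ?cats0 ?take_oversize // leqW.
- by move=> x g h; rewrite /ell evkB.
- move=> x g h [nx sx] x0 gh.
  have sx' : size x = (size x).-1.+1 by rewrite prednK.
  apply: KP.
  + have ltx : ((size x).-1 < N.+1)%N by rewrite prednK.
    by apply: leq_trans kK; apply: (leq_bigmax (Ordinal ltx)).
  + exact: ltup_nil2.
  + move=> l sl lx; apply: gh => [|y /lx /codomP[i ->]]; first by rewrite sl.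
    by rewrite mem_nth //; apply: leq_trans (ltn_ord i) _; rewrite -sx'.
- move=> x g [nx sx]; case sz : (size x) => [//|[//|n]] _.
  rewrite (ellE _ _ sz) -evk_cobd /cobd sz; apply: eq_bigr => i _.
  rewrite (@ellE _ n) ?sing_face_ltup // size_del ?sz //.
- move=> x c sx; rewrite (ellE _ _ sx) /evk.
  by elim: k {kK} (vertices R 0) => [//|k IH] w; exact: IH.
- by move=> i iN; split; [exact: nX|rewrite size_del ?sX].
- by move=> l [nl _] l' sl' l'l; apply: f0 => //; exact: nil2_sub l'l nl.
Qed.

(** If bd X, as a singular cycle, were the boundary of c, then f would take the value (df)(c) = 0 on
    it; by [ell_sphere] that value is (df)(X). *)
Theorem homology_detect (e n : nat) (f : seq G -> B) X :
  (forall l, f l *+ e = 0) ->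
  (forall l, size l = n.+3 -> nil2 l -> cobd f l = 0) ->
  size X = n.+3 -> (forall i, (i < n.+3)%N -> nil2 (del i X)) ->
  singular_homology_eq0 R Y (Zmod e) n.+1 -> cobd f X = 0.
Proof.
move=> fe f0 sX nX H0.
pose psi m v : singular_chain R Y (Zmod e) m :=
  mkmalgU (sing_cell R (@ltup G m v)) (zone e).
(* The faces of X with coefficient 1 in Z/e. As [psi] is a cochain with values in chains, the cycle
   condition is that a double coboundary vanishes. *)
have [c _ cz] : singular_boundary (cobd (psi n.+1) X).
  apply: H0; rewrite /singular_cycle /=.
  transitivity (cobd (cobd (psi n)) X); last exact: cobd_cobd.
  rewrite {1}/cobd singular_bdE lin_sum; last exact: bd_atD.
  apply: eq_bigr => i _; rewrite linMz; last exact: bd_atD.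
  rewrite linU; last exact: bd_atD.
  have sd : size (del i X) = n.+2 by rewrite size_del ?sX.
  congr (_ *~ _); rewrite /bd_at /cobd sd; apply: eq_bigr => j _.
  rewrite sing_face_ltup //; last by apply: nX; rewrite -sX.
  exact: raddfMz.
have [k0 k0P] := ell_sphere n.+1.
pose K s := sval (cid (@eq_evk R G B n.+2 s)).
have KP s k : (K s <= k)%N -> forall f g : seq G -> B,
    (forall l, size l = n.+3 -> nil2 l -> f l = g l) -> evk k s f = evk k s g.
  by move: k; rewrite /K; case: (cid _).
(* Large enough for the sphere and for the finitely many simplices of c. *)
pose k := maxn k0 (\max_(s <- msupp c) K s).
pose phi m (s : singular_simplex R Y m) (x : Zmod e) := evk k s (fun l => zact x (f l)).
have phiD m : additive_at (phi m).
  move=> s x y; rewrite /phi -evkD; congr evk.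
  by apply/funext => l; rewrite zactDl.
have phiMz m s x (z : int) : phi m s (x *~ z) = phi m s x *~ z.
  have phiMn p : phi m s (x *+ p) = phi m s x *+ p.
    elim: p => [|p IH]; first by rewrite mulr0n lin_at0.
    by rewrite !mulrS phiD IH.
  by case: z => p; rewrite ?NegzE -?pmulrn ?mulrNz ?(lin_atN (phiD m)) -?pmulrn phiMn.
have : lin (phi n.+1) (singular_bd c) = 0.
  rewrite lin_singular_bd // /lin big_seq big1 // => s sc.
  under eq_bigr do rewrite phiMz.
  rewrite evk_cobd -[RHS](evk0 B k s); apply: KP => [|l sl nl].
    by rewrite /k leq_max (leq_bigmax_seq _ sc) // orbT.
  rewrite (cobd_additive (h := zact _)) ?f0 //; last exact: zactDr.
  exact: zactr0.
rewrite cz -(k0P k _ X f sX nX f0) ?leq_maxl // => <-.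
rewrite {1}/cobd lin_sum //; apply: eq_bigr => i _.
rewrite linMz // linU //; congr (_ *~ _).
rewrite (@ellE _ n.+1) ?size_del ?sX // /phi; congr evk.
by apply/funext => l; rewrite zact1.
Qed.

End Detection.

(** * The cone operator *)

Section RealFunctions.
Variables (R : realType) (Z : topologicalType).
Implicit Types f g : Z -> R.

Lemma fun_continuousB f g : continuous f -> continuous g ->
  continuous (fun z => f z - g z).
Proof. by move=> fc gc z; exact: cvgB (fc z) (gc z). Qed.

Lemma fun_continuousD f g : continuous f -> continuous g ->
  continuous (fun z => f z + g z).
Proof. by move=> fc gc z; exact: cvgD (fc z) (gc z). Qed.

Lemma fun_continuousM f g : continuous f -> continuous g ->
  continuous (fun z => f z * g z).
Proof. by move=> fc gc z; exact: cvgM (fc z) (gc z). Qed.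

Lemma fun_continuousV f : (forall z, f z != 0) -> continuous f ->
  continuous (fun z => (f z)^-1).
Proof. by move=> f0 fc z; exact: cvgV (f0 z) (fc z). Qed.

Lemma fun_continuous_max f g : continuous f -> continuous g ->
  continuous (fun z => Order.max (f z) (g z)).
Proof. by move=> fc gc z; exact: continuous_max (fc z) (gc z). Qed.

Lemma fun_continuous_min f g : continuous f -> continuous g ->
  continuous (fun z => Order.min (f z) (g z)).
Proof. by move=> fc gc z; exact: continuous_min (fc z) (gc z). Qed.

Lemma fun_continuous_cst (c : R) : continuous (fun _ : Z => c).
Proof. exact: cst_continuous. Qed.

End RealFunctions.

Section Lines.
Variable R : realType.
Local Notation simplex := (std_simplex R).

(** Clamping to [0,1] lets homotopies be parametrized by all of R. *)
Definition clip (s : R) : R := Order.max 0 (Order.min 1 s).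

Lemma clip_ge0 s : 0 <= clip s.
Proof. by rewrite le_max lexx. Qed.

Lemma clip_le1 s : clip s <= 1.
Proof. by rewrite ge_max ler01 ge_min lexx. Qed.

Lemma clip0 : clip 0 = 0.
Proof. by rewrite /clip min_r // maxxx. Qed.

Lemma clip1 : clip 1 = 1.
Proof. by rewrite /clip minxx max_r. Qed.

Lemma clip_continuous : continuous clip.
Proof.
apply: fun_continuous_max; first exact: fun_continuous_cst.
apply: fun_continuous_min; first exact: fun_continuous_cst.
by move=> s; exact: cvg_id.
Qed.

Definition line n (s : R) (a b : simplex n) : simplex n :=
  mk_simplex (fun j => (1 - clip s) * bcoord a j + clip s * bcoord b j).

Lemma bcoord_line n s (a b : simplex n) j :
  bcoord (line s a b) j = (1 - clip s) * bcoord a j + clip s * bcoord b j.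
Proof.
have := clip_ge0 s; have := clip_le1 s => c1 c0; rewrite bcoord_mk // => [i|].
  by rewrite addr_ge0 // mulr_ge0 ?bcoord_ge0 // subr_ge0.
by rewrite big_split /= -!mulr_sumr !bcoord_sum !mulr1 subrK.
Qed.

Lemma line0 n (a b : simplex n) : line 0 a b = a.
Proof.
by apply: bcoord_inj => j; rewrite bcoord_line clip0 subr0 mul1r mul0r addr0.
Qed.

Lemma line1 n (a b : simplex n) : line 1 a b = b.
Proof.
by apply: bcoord_inj => j; rewrite bcoord_line clip1 subrr mul1r mul0r add0r.
Qed.

Lemma line_map m n (f : 'I_m.+1 -> 'I_n.+1) s (a b : simplex m) :
  std_simplex_map f (line s a b) = line s (std_simplex_map f a) (std_simplex_map f b).
Proof.
apply: bcoord_inj => j; rewrite bcoord_line !bcoord_map.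
by rewrite !mulr_sumr -big_split; apply: eq_bigr => i _; rewrite bcoord_line.
Qed.

Lemma line_continuous (Z : topologicalType) n (s : Z -> R) (a b : Z -> simplex n) :
  continuous s -> continuous a -> continuous b ->
  continuous (fun z => line (s z) (a z) (b z)).
Proof.
move=> sc ac bc; apply: to_simplex_continuous => j.
have -> : (fun z => bcoord (line (s z) (a z) (b z)) j) = (fun z =>
    (1 - clip (s z)) * bcoord (a z) j + clip (s z) * bcoord (b z) j).
  by apply/funext => z; rewrite bcoord_line.
have cc : continuous (clip \o s).
  by move=> z; apply: continuous_comp; [exact: sc|exact: clip_continuous].
have coordc (c : Z -> simplex n) : continuous c -> continuous (fun z => bcoord (c z) j).
  move=> cc' z.
  apply: (@continuous_comp _ _ _ c (fun t => bcoord t j)); first exact: cc'.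
  exact: bcoord_continuous.
apply: fun_continuousD; apply: fun_continuousM; [|exact: coordc|exact: cc|exact: coordc].
by apply: fun_continuousB; [exact: fun_continuous_cst|exact: cc].
Qed.

Lemma clip_bcoord_continuous n :
  continuous (fun u : simplex n.+1 => clip (2 * bcoord u ord0)).
Proof.
move=> u; apply: (@continuous_comp _ _ _ (fun u : simplex n.+1 =>
  2 * bcoord u ord0) clip); last exact: clip_continuous.
apply: (@fun_continuousM R _ (fun=> 2) (fun u => bcoord u ord0)).
  exact: fun_continuous_cst.
exact: bcoord_continuous.
Qed.

End Lines.

Section ConeOperator.
Variables (R : realType) (Z Y : topologicalType) (h : R -> Z -> Y).
Local Notation simplex := (std_simplex R).
Hypothesis hc : continuous (fun sz : R * Z => h sz.1 sz.2).

(** Equal to 1 - u0 as long as u0 is at most 1/2, and bounded away from 0 near the vertex 0. The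
    mass lost by dividing by it goes to the vertex 0 of the base. *)
Let scale n (u : simplex n.+1) : R := Order.max (1 - bcoord u ord0) 2^-1.

Let scale_gt0 n (u : simplex n.+1) : 0 < scale u.
Proof. by rewrite lt_max invr_gt0 ltr0n orbT. Qed.

(* The projection of the simplex from the vertex 0 onto the opposite face; it is
   modified near the vertex 0, where h is already constant, to be continuous. *)
Definition cone_base n (u : simplex n.+1) : simplex n := mk_simplex (fun i =>
  bcoord u (lift ord0 i) / scale u +
  (i == ord0)%:R * (1 - (1 - bcoord u ord0) / scale u)).

Lemma bcoord_cone_base n (u : simplex n.+1) i : bcoord (cone_base u) i =
  bcoord u (lift ord0 i) / scale u +
  (i == ord0)%:R * (1 - (1 - bcoord u ord0) / scale u).
Proof.
have s0 := scale_gt0 u; rewrite bcoord_mk // => [j|].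
  rewrite addr_ge0 // ?divr_ge0 ?bcoord_ge0 ?(ltW s0) // mulr_ge0 ?ler0n //.
  by rewrite subr_ge0 ler_pdivrMr // mul1r le_max lexx.
rewrite big_split /= -mulr_suml.
have -> : \sum_(j < n.+1) bcoord u (lift ord0 j) = 1 - bcoord u ord0.
  by have := bcoord_sum u; rewrite big_ord_recl => <-; rewrite addrC addKr.
rewrite [X in _ + X](bigD1 ord0) //= ?eqxx mul1r big1 ?addr0.
  by rewrite addrC subrK.
by move=> j /negbTE ->; rewrite mul0r.
Qed.

Lemma cone_base_continuous n : continuous (@cone_base n).
Proof.
apply: to_simplex_continuous => i.
have -> : (fun u : simplex n.+1 => bcoord (cone_base u) i) = (fun u =>
    bcoord u (lift ord0 i) * (scale u)^-1 +
    (i == ord0)%:R * (1 - (1 - bcoord u ord0) * (scale u)^-1)).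
  by apply/funext => u; rewrite bcoord_cone_base.
have c1 : continuous (fun u : simplex n.+1 => 1 - bcoord u ord0).
  by apply: fun_continuousB; [exact: fun_continuous_cst|exact: bcoord_continuous].
have c2 : continuous (fun u : simplex n.+1 => (scale u)^-1).
  apply: fun_continuousV; first by move=> u; rewrite gt_eqF.
  by apply: fun_continuous_max => //; exact: fun_continuous_cst.
apply: fun_continuousD; apply: fun_continuousM => //.
- exact: bcoord_continuous.
- exact: fun_continuous_cst.
- by apply: fun_continuousB; [exact: fun_continuous_cst|exact: fun_continuousM].
Qed.

(** The factor 2 makes the time reach 1 at u0 = 1/2, just where [cone_base] stops being the true
    projection. *)
Definition cone_fun n (s : singular_simplex R Z n) (u : simplex n.+1) : Y :=
  h (clip (2 * bcoord u ord0)) (s (cone_base u)).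

Lemma cone_fun_continuous n (s : singular_simplex R Z n) : continuous (cone_fun s).
Proof.
have Ac := @clip_bcoord_continuous R n.
have Bc : continuous (s \o @cone_base n).
  move=> u; apply: continuous_comp; first exact: cone_base_continuous.
  exact: cts_fun.
move=> u; apply: (@continuous_comp _ _ _ (fun u : simplex n.+1 =>
  (clip (2 * bcoord u ord0), s (cone_base u))) (fun sz : R * Z => h sz.1 sz.2)).
  exact: cvg_pair (Ac u) (Bc u).
exact: hc.
Qed.

Definition cone n (s : singular_simplex R Z n) : singular_simplex R Y n.+1 :=
  mkcts (@cone_fun_continuous n s).

Lemma cone_face0 n (s : singular_simplex R Z n) t :
  singular_face ord0 (cone s) t = h 0 (s t).
Proof.
rewrite -[LHS]/(cone_fun s (std_simplex_map (lift ord0) t)) /cone_fun.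
have t0 : bcoord (std_simplex_map (lift ord0) t) ord0 = 0.
  by rewrite bcoord_map_lift unlift_none.
have sc1 : scale (std_simplex_map (lift ord0) t) = 1.
  by rewrite /scale t0 subr0 max_l // invf_le1 ?ltr0n // ler1n.
rewrite t0 mulr0 clip0; congr (h 0 (s _)); apply: bcoord_inj => i.
by rewrite bcoord_cone_base sc1 t0 subr0 !divr1 subrr mulr0 addr0 bcoord_map_lift liftK.
Qed.

(** For u0 at least 1/2 the two base points may differ, but the time is 1 and h 1 is constant on s.
    Elsewhere the base is the true projection, which commutes with faces. *)
Lemma cone_faceS n (s : singular_simplex R Z n.+1) (i : 'I_n.+2) :
  (forall t t', h 1 (s t) = h 1 (s t')) ->
  singular_face (lift ord0 i) (cone s) = cone (singular_face i s).
Proof.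
move=> s1; apply/continuousEP => u.
rewrite -[LHS]/(cone_fun s (std_simplex_map (lift (lift ord0 i)) u)).
rewrite -[RHS]/(cone_fun (singular_face i s) u) /cone_fun.
rewrite -[singular_face i s _]/(s (std_simplex_map (lift i) (cone_base u))).
have E0 : bcoord (std_simplex_map (lift (lift ord0 i)) u) ord0 = bcoord u ord0.
  rewrite bcoord_map_lift; have -> : ord0 = lift (lift ord0 i) ord0 by exact: ord_inj.
  by rewrite liftK.
rewrite E0; have [u1|u1] := leP 2^-1 (bcoord u ord0).
  have -> : clip (2 * bcoord u ord0) = 1; last exact: s1.
  rewrite /clip min_l ?max_r ?ler01 //.
  by rewrite -ler_pdivrMl ?ltr0n // mulr1.
have sE v : bcoord v ord0 = bcoord u ord0 -> scale v = 1 - bcoord u ord0.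
  by move=> vu; rewrite /scale vu max_l //; move: u1; lra.
congr (h _ (s _)); apply: bcoord_inj => j.
have nz : 1 - bcoord u ord0 != 0 by rewrite gt_eqF //; move: u1; lra.
rewrite bcoord_cone_base (sE _ _ E0) E0 divff // subrr mulr0 addr0.
rewrite !bcoord_map_lift; case: (unliftP i j) => [k ->|->].
  have -> : lift ord0 (lift i k) = lift (lift ord0 i) (lift ord0 k).
    by apply: ord_inj; rewrite /= /bump /=; lia.
  rewrite liftK bcoord_cone_base (sE _ u) // divff // subrr mulr0 addr0 //.
by rewrite unlift_none mul0r.
Qed.

Section ConeBoundary.
Variable A : zmodType.
Implicit Type x : A.

Lemma bd_cone n (s : singular_simplex R Z n.+1) x (s0 : singular_simplex R Y n.+1) :
  (forall t t', h 1 (s t) = h 1 (s t')) -> s0 =1 h 0 \o s ->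
  bd_at (cone s) x = mkmalgU s0 x -
    \sum_(i < n.+2) mkmalgU (cone (singular_face i s)) (x *~ (-1) ^+ i).
Proof.
move=> s1 s0E; rewrite /bd_at big_ord_recl expr0 mulr1z; congr (_ + _).
  congr (mkmalgU _ _); apply/continuousEP => t; rewrite s0E; exact: cone_face0.
rewrite -sumrN; apply: eq_bigr => i _; rewrite cone_faceS //.
by rewrite -monalgUN -mulrNz /= /bump add1n exprS mulN1r.
Qed.

End ConeBoundary.
End ConeOperator.

Section Contractible.
Variables (R : realType) (Y : topologicalType) (h : R -> Y -> Y).
Hypothesis hc : continuous (fun sz : R * Y => h sz.1 sz.2).
Hypothesis h0 : forall p, h 0 p = p.
Hypothesis h1 : forall p q, h 1 p = h 1 q.

(** By [bd_cone] the cone operator is a contracting chain homotopy, so the cone over a cycle has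
    that cycle as its boundary. *)
Lemma contractible_homology0 (A : zmodType) n :
  singular_homology_eq0 R Y A n.+1.
Proof.
move=> c /= cz; pose phi m (s : singular_simplex R Y m) (x : A) :
  singular_chain R Y A m.+1 := mkmalgU (cone hc s) x.
have phiD m : additive_at (phi m) by move=> s x y; exact: monalgUD.
exists (lin (phi n.+1) c) => //.
rewrite /lin singular_bd_sum.
transitivity (\sum_(s <- msupp c) (mkmalgU s (mcoeff s c) -
    \sum_(i < n.+2) phi n (singular_face i s) (mcoeff s c *~ (-1) ^+ i))).
  apply: eq_bigr => s _; rewrite singular_bdU.
  by apply: bd_cone => [t t'|t]; [exact: h1|rewrite /= h0].
have := lin_singular_bd c (phiD n); rewrite cz lin0 // => /esym phi0.
by rewrite sumrB -monalgE; move: phi0; rewrite /lin => ->; rewrite subr0.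
Qed.

End Contractible.

(** * Star contractions *)

Section ConeHomotopy.
Variables (R : realType) (G : groupType).
Local Notation simplex := (std_simplex R).
Local Notation Y := (E3 R G).

Definition consf (g : G) n (x : 'I_n.+1 -> G) (i : 'I_n.+2) : G :=
  if unlift ord0 i is Some j then x j else g.

Lemma consf0 g n (x : 'I_n.+1 -> G) : consf g x ord0 = g.
Proof. by rewrite /consf unlift_none. Qed.

Lemma consfS g n (x : 'I_n.+1 -> G) j : consf g x (lift ord0 j) = x j.
Proof. by rewrite /consf liftK. Qed.

Lemma consf_lift g n (x : 'I_n.+1 -> G) : consf g x \o lift ord0 = x.
Proof. by apply/funext => j; exact: consfS. Qed.

(** It sends cofaces to cofaces and codegeneracies to codegeneracies, which makes the insertion of g
    as first vertex compatible with the gluing. *)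
Definition liftf m n (f : 'I_m.+1 -> 'I_n.+1) (i : 'I_m.+2) : 'I_n.+2 :=
  if unlift ord0 i is Some j then lift ord0 (f j) else ord0.

Lemma liftf_lift m n (f : 'I_m.+1 -> 'I_n.+1) :
  liftf f \o lift ord0 = lift ord0 \o f.
Proof. by apply/funext => i; rewrite /liftf /= liftK. Qed.

Lemma liftf0 m n (f : 'I_m.+1 -> 'I_n.+1) : liftf f ord0 = ord0.
Proof. by rewrite /liftf unlift_none. Qed.

Lemma consf_comp g m n (x : 'I_n.+1 -> G) (f : 'I_m.+1 -> 'I_n.+1) :
  consf g (x \o f) = consf g x \o liftf f.
Proof.
apply/funext => i; case: (unliftP ord0 i) => [j ->|->].
  by rewrite consfS /liftf /= liftK consfS.
by rewrite /= liftf0 !consf0.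
Qed.

Lemma liftf_face n (i : 'I_n.+2) : liftf (lift i) = lift (lift ord0 i).
Proof.
apply/funext => j; apply: ord_inj; case: (unliftP ord0 j) => [k ->|->].
  by rewrite /liftf liftK /= /bump /=; lia.
by rewrite liftf0.
Qed.

Lemma liftf_degen n (i : 'I_n.+1) : liftf (codegen i) = codegen (lift ord0 i).
Proof.
apply/funext => j; apply: ord_inj; case: (unliftP ord0 j) => [k ->|->].
  by rewrite /liftf liftK /= !codegenE /= /bump /unbump /=; lia.
by rewrite liftf0 codegenE.
Qed.

Section Homotopy.
Variables (g : G) (m : Y -> R).
Hypothesis mc : continuous m.
Hypothesis m0 : forall n (x : E3_simplex G n) t,
  ~ affinely_nil2 (consf g (set_val x)) -> m (cell_point x t) = 0.

(** Motion towards the new vertex g with speed m inside the cell of g followed by x. If that tuple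
    is not a simplex the point rests, which fits because m vanishes on such x. *)
Let F s n (x : E3_simplex G n) (t : simplex n) : Y :=
  if pselect (affinely_nil2 (consf g (set_val x))) then
    cellf (consf g (set_val x))
      (line (s * m (cell_point x t)) (std_simplex_map (lift ord0) t) (vertex R ord0))
  else cell_point x t.

Let F_compat k n (f : 'I_k.+1 -> 'I_n.+1) s (x : E3_simplex G n) t :
  (forall (y : 'I_n.+2 -> G) (u : simplex k.+1), affinely_nil2 y ->
     cellf (y \o liftf f) u = cellf y (std_simplex_map (liftf f) u)) ->
  cell_point (E3_pull f x) t = cell_point x (std_simplex_map f t) ->
  F s (E3_pull f x) t = F s x (std_simplex_map f t).
Proof.
move=> ff fx; rewrite /F fx.
have -> : consf g (set_val (E3_pull f x)) = consf g (set_val x) \o liftf f.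
  by rewrite -consf_comp.
case: pselect => [nx'|nx']; case: pselect => [nx|nx] //=.
- rewrite ff // line_map vertex_map liftf0 !std_simplex_map_comp.
  by rewrite liftf_lift.
(* The face can be coned with g but x cannot: m is 0 at this point, so both formulas leave it
   fixed. *)
- rewrite m0 // mulr0 line0 -consf_comp.
  rewrite -cellf_face; last by rewrite consf_comp.
  by rewrite consf_lift -[_ \o f]/(set_val (E3_pull f x)) cellfE.
- by case: nx'; exact: affinely_nil2_pull.
Qed.

Definition cone_htpy (s : R) : Y -> Y := descend (F s).

Lemma cone_htpyE s n (x : E3_simplex G n) t : cone_htpy s (cell_point x t) = F s x t.
Proof.
apply: descendE => k i y u; apply: F_compat.
- by rewrite liftf_face => z v; exact: cellf_face.
- exact: cell_point_face.
- by rewrite liftf_degen => z v; exact: cellf_degen.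
- exact: cell_point_degen.
Qed.

Lemma cone_htpy_nil2 s n (x : E3_simplex G n) t :
  affinely_nil2 (consf g (set_val x)) -> cone_htpy s (cell_point x t) =
    cellf (consf g (set_val x))
      (line (s * m (cell_point x t)) (std_simplex_map (lift ord0) t) (vertex R ord0)).
Proof. by rewrite cone_htpyE /F => nx; case: pselect. Qed.

Lemma cone_htpy0 p : cone_htpy 0 p = p.
Proof.
have [n [x [t ->]]] := cell_point_surj p; rewrite cone_htpyE /F.
case: pselect => // nx; rewrite mul0r line0 -cellf_face //.
by rewrite consf_lift cellfE.
Qed.

Lemma cone_htpy1 p : m p = 1 ->
  cone_htpy 1 p = cellf (fun _ : 'I_1 => g) (vertex R ord0).
Proof.
have [n [x [t ->]]] := cell_point_surj p => m1; rewrite cone_htpyE /F.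
case: pselect => [nx|nx] /=; last first.
  by have := m0 t nx; rewrite m1 => /eqP; rewrite oner_eq0.
rewrite m1 mulr1 line1.
have -> : vertex R (@ord0 n.+1) = std_simplex_map (fun _ : 'I_1 => ord0) (vertex R ord0).
  by rewrite vertex_map.
rewrite -cellf_initial //; last by move=> i; rewrite ord1.
by congr cellf; apply/funext => i; rewrite /= consf0.
Qed.

Lemma cone_htpy_continuous : continuous (fun sp : R * Y => cone_htpy sp.1 sp.2).
Proof.
apply: E3_htpy_continuous => n x.
have pc : continuous (fun st : R * simplex n => cell_point x st.2).
  move=> st; apply: (@continuous_comp _ _ _ snd (cell_point x)); first exact: cvg_snd.
  exact: cell_point_continuous.
have [nx|nx] := pselect (affinely_nil2 (consf g (set_val x))); last first.
  have -> : (fun st : R * simplex n => cone_htpy st.1 (cell_point x st.2)) =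
      (fun st => cell_point x st.2); last exact: pc.
  by apply/funext => st; rewrite cone_htpyE /F; case: pselect.
have -> : (fun st : R * simplex n => cone_htpy st.1 (cell_point x st.2)) =
    cellf (consf g (set_val x)) \o (fun st => line (st.1 * m (cell_point x st.2))
      (std_simplex_map (lift ord0) st.2) (vertex R ord0)).
  by apply/funext => st; rewrite cone_htpy_nil2.
move=> st; apply: continuous_comp; last exact: cellf_continuous.
apply: line_continuous.
- apply: fun_continuousM; first by move=> ?; exact: cvg_fst.
  move=> z; apply: (@continuous_comp _ _ _ (fun st : R * simplex n =>
    cell_point x st.2) m); [exact: pc|exact: mc].
- move=> z; apply: (@continuous_comp _ _ _ snd (std_simplex_map (lift ord0))).
    exact: cvg_snd.
  exact: std_simplex_map_continuous.
- exact: cst_continuous.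
Qed.

End Homotopy.

(** All tuples are simplices, so m = 1 is allowed and the homotopy contracts everything to the
    vertex 1. *)
Lemma nilpotent2_homology0 (A : zmodType) n :
  nilpotent_class_le 2 [set: G] -> singular_homology_eq0 R Y A n.+1.
Proof.
move=> nG; have nil k (x : 'I_k.+1 -> G) : affinely_nil2 x.
  by exists 1%g, [set: G]; split.
have m0 k (x : E3_simplex G k) (t : simplex k) :
    ~ affinely_nil2 (consf 1%g (set_val x)) -> (fun _ : Y => 1 : R) (cell_point x t) = 0.
  by move/(_ (nil _ _)).
have mc : continuous (fun _ : Y => 1 : R) by exact: cst_continuous.
apply: (contractible_homology0 (cone_htpy_continuous mc m0)) => [p|p q].
  exact: cone_htpy0.
by rewrite !cone_htpy1.
Qed.

End ConeHomotopy.

(** * Path classes modulo boundaries *)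

Section BoundaryQuotient.
Variables (R : realType) (Y : topologicalType) (A : zmodType) (n : nat).

Definition boundary_pred : {pred singular_chain R Y A n} :=
  [pred c | `[< singular_boundary c >]].

Lemma boundary_zmod_closed : zmod_closed boundary_pred.
Proof.
split=> [|c d /asboolP[c' _ <-] /asboolP[d' _ <-]]; apply/asboolP.
  by exists 0 => //; exact: singular_bd0.
by exists (c' - d') => //; rewrite singular_bdD singular_bdN.
Qed.

HB.instance Definition _ :=
  GRing.isZmodClosed.Build _ boundary_pred boundary_zmod_closed.

(** Working with classes modulo boundaries replaces the construction of explicit 2-chains by
    equations in an abelian group. *)
Lemma boundary_quotient :
  exists (Q : zmodType) (q : singular_chain R Y A n -> Q),
    {morph q : c d / c + d} /\ forall c, q c = 0 <-> singular_boundary c.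
Proof.
exists (Quotient.quot boundary_pred), (\pi_(Quotient.quot boundary_pred))%qT.
split=> [c d|c]; first by rewrite piE.
rewrite -[0](raddf0 (\pi_(Quotient.quot boundary_pred))%qT).
split=> [/eqP|cb]; first by rewrite -Quotient.idealrBE subr0 => /asboolP.
by apply/eqP; rewrite -Quotient.idealrBE subr0; exact/asboolP.
Qed.

End BoundaryQuotient.

Section PathClasses.
Variables (R : realType) (Y : topologicalType) (A Q : zmodType).
Local Notation simplex := (std_simplex R).
Variable q : singular_chain R Y A 1 -> Q.
Hypothesis qD : {morph q : c d / c + d}.
Hypothesis q_bd : forall d, q (singular_bd d) = 0.

Let q0 : q 0 = 0.
Proof. by apply: (addrI (q 0)); rewrite -qD !addr0. Qed.

Let qN c : q (- c) = - q c.
Proof. by apply: (addrI (q c)); rewrite -qD !subrr. Qed.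

Definition path_class (a : A) (s : singular_simplex R Y 1) : Q := q (mkmalgU s a).

Lemma path_classD s : {morph (path_class^~ s) : a b / a + b}.
Proof. by move=> a b; rewrite /path_class monalgUD qD. Qed.

Definition sing_pt (Z : topologicalType) (z : Z) : singular_simplex R Z 0 :=
  mkcts (@cst_continuous (simplex 0) Z z).

Lemma simplex0 (t : simplex 0) : t = vertex R ord0.
Proof.
apply: bcoord_inj => j; rewrite bcoord_vertex !ord1 eqxx.
by have := bcoord_sum t; rewrite big_ord1.
Qed.

Definition v0 : simplex 1 := vertex R ord0.
Definition v1 : simplex 1 := vertex R (lift ord0 ord0).

Lemma path_face0 (Z : topologicalType) (s : singular_simplex R Z 1) :
  singular_face ord0 s = sing_pt (s v1).
Proof.
apply/continuousEP => t; rewrite (simplex0 t) /=.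
by rewrite vertex_map.
Qed.

Lemma path_face1 (Z : topologicalType) (s : singular_simplex R Z 1) :
  singular_face (lift ord0 ord0) s = sing_pt (s v0).
Proof.
apply/continuousEP => t; rewrite (simplex0 t) /=.
by rewrite vertex_map; congr (s (vertex R _)); exact: ord_inj.
Qed.

(** The cone over a path is a 2-simplex whose other two sides are the tracks of the endpoints under
    the homotopy. *)
Lemma cone_path_class (Z : topologicalType) (h : R -> Z -> Y)
    (hc : continuous (fun sz : R * Z => h sz.1 sz.2))
    a (s : singular_simplex R Z 1) (s0 : singular_simplex R Y 1) :
  (forall t t', h 1 (s t) = h 1 (s t')) -> s0 =1 h 0 \o s ->
  path_class a s0 = path_class a (cone hc (sing_pt (s v1))) -
    path_class a (cone hc (sing_pt (s v0))).
Proof.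
move=> s1 s0E; have := q_bd (mkmalgU (cone hc s) a).
rewrite singular_bdU (bd_cone hc a s1 s0E) qD qN => /eqP; rewrite subr_eq0 => /eqP.
rewrite /path_class => ->; rewrite big_ord_recl big_ord1 expr0 expr1 mulr1z mulrN1z.
by rewrite monalgUN qD qN path_face0 path_face1.
Qed.

Section InCell.
Variables (N : nat) (phi : simplex N -> Y).
Hypothesis phic : continuous phi.

Lemma cell_contraction_continuous :
  continuous (fun st : R * simplex N => phi (line st.1 st.2 (vertex R ord0))).
Proof.
move=> st; apply: (@continuous_comp _ _ _ (fun st : R * simplex N =>
  line st.1 st.2 (vertex R ord0)) phi); last exact: phic.
apply: line_continuous; first by move=> ?; exact: cvg_fst.
  by move=> ?; exact: cvg_snd.
exact: cst_continuous.
Qed.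

(** The class of the image of the segment from the vertex 0 to t. *)
Definition radius (a : A) (t : simplex N) : Q :=
  path_class a (cone (h := fun s t => phi (line s t (vertex R ord0)))
    cell_contraction_continuous (sing_pt t)).

(** [cone_path_class] for the linear contraction of the simplex to its vertex 0. *)
Lemma path_class_in_cell a (gam : simplex 1 -> simplex N)
    (s0 : singular_simplex R Y 1) : continuous gam -> s0 =1 phi \o gam ->
  path_class a s0 = radius a (gam v1) - radius a (gam v0).
Proof.
move=> gc s0E; apply: (cone_path_class cell_contraction_continuous a (s := mkcts gc)).
  by move=> t t'; rewrite !line1.
by move=> t; rewrite s0E /= line0.
Qed.

End InCell.
End PathClasses.

Lemma subr_swap (V : zmodType) (a b c d : V) : a - b = c - d -> a - c = b - d.
Proof.
by move=> /eqP; rewrite subr_eq => /eqP ->; rewrite addrAC (addrAC c) subrr add0r addrC.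
Qed.

Section EdgePaths.
Variables (R : realType) (G : groupType) (A Q : zmodType).
Local Notation simplex := (std_simplex R).
Local Notation Y := (E3 R G).
Variable q : singular_chain R Y A 1 -> Q.
Hypothesis qD : {morph q : c d / c + d}.
Hypothesis q_bd : forall d, q (singular_bd d) = 0.
Hypothesis full : forall x y z : G, nil2 [:: x; y; z].
Local Notation cls := (path_class q).

Definition edge (g g' : G) : singular_simplex R Y 1 :=
  sing_cell R (@ltup G 1 [:: g; g']).

Lemma edgeD a g g' g'' : cls a (edge g g') + cls a (edge g' g'') = cls a (edge g g'').
Proof.
have q0 : q 0 = 0 by apply: (addrI (q 0)); rewrite -qD !addr0.
have qN c : q (- c) = - q c by apply: (addrI (q c)); rewrite -qD !subrr.
have := q_bd (mkmalgU (sing_cell R (@ltup G 2 [:: g; g'; g''])) a).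
rewrite singular_bdU /bd_at !big_ord_recl big_ord0.
rewrite !sing_face_ltup // addr0 expr0 /= /bump /= !addn0 expr1 sqrrN expr1n.
rewrite !mulr1z mulrN1z monalgUN !qD qN /path_class addrA => /eqP.
by rewrite -addrA addrCA addrC subr_eq0 addrC => /eqP.
Qed.

Lemma end_path_continuous n (x : 'I_n.+1 -> G) (t : simplex n) :
  continuous (fun u : simplex 1 => cellf x (line (bcoord u ord0) t (vertex R ord0))).
Proof.
move=> u; apply: (@continuous_comp _ _ _ (fun u : simplex 1 =>
  line (bcoord u ord0) t (vertex R ord0)) (cellf x)); last exact: cellf_continuous.
by apply: line_continuous; [exact: bcoord_continuous| |]; exact: cst_continuous.
Qed.

(** Runs from the first vertex of the cell to its point t, since [v0] has coordinate 1 at [ord0]. *)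
Definition end_path n (x : 'I_n.+1 -> G) (t : simplex n) : singular_simplex R Y 1 :=
  mkcts (@end_path_continuous n x t).

(** E1 p followed by E2 p leads from the vertex 1 to p through the first vertex of a cell chosen
    once for each p, independently of g and m. The track of p under the star contraction starts at
    g, hence the correction by the edge from 1 to g. *)
Lemma cone_htpy_class : exists E1 E2 : Y -> singular_simplex R Y 1,
  forall a p g (m : Y -> R) (mc : continuous m)
    (m0 : forall n (x : E3_simplex G n) t,
      ~ affinely_nil2 (consf g (set_val x)) -> m (cell_point x t) = 0),
  m p = 1 ->
  cls a (cone (cone_htpy_continuous mc m0) (sing_pt R p)) =
  cls a (E1 p) + cls a (E2 p) - cls a (edge 1%g g).
Proof.
have rep (p : Y) : exists nxt : {n : nat & E3_simplex G n * simplex n}%type,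
    p = cell_point (tagged nxt).1 (tagged nxt).2.
  have [n [x [t ->]]] := cell_point_surj p.
  by exists (Tagged (fun n => E3_simplex G n * simplex n)%type (x, t)).
have [r rE] := choice rep.
exists (fun p => edge 1%g (set_val (tagged (r p)).1 ord0)),
  (fun p => end_path (set_val (tagged (r p)).1) (tagged (r p)).2).
move=> a p g m mc m0 m1.
move: (rE p); case: (r p) => n [x t] /= pE.
have nx : affinely_nil2 (consf g (set_val x)).
  apply: contrapT => /(m0 n x t); rewrite -pE m1 => /eqP; rewrite oner_eq0 //.
(* The track, the end path and the edge from g to the first vertex of x all run in this cell, so
   each class is a difference of radii. *)
pose phi : simplex n.+1 -> Y := cellf (consf g (set_val x)).
have phic : continuous phi by exact: cellf_continuous.
have c1 : cls a (cone (cone_htpy_continuous mc m0) (sing_pt R p)) =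
    radius q phic a (std_simplex_map (lift ord0) t) - radius q phic a (vertex R ord0).
  rewrite (path_class_in_cell qD q_bd phic a (gam := fun u : simplex 1 =>
    line (clip (2 * bcoord u ord0)) (std_simplex_map (lift ord0) t) (vertex R ord0))).
  - rewrite !bcoord_vertex /= mulr0 clip0 line0 mulr1.
    have -> : clip (2 : R) = 1 by rewrite /clip min_l ?max_r ?ler01 // ler1n.
    by rewrite line1.
  - by apply: line_continuous; [exact: clip_bcoord_continuous| |]; exact: cst_continuous.
  - move=> u; transitivity (cone_htpy g m (clip (2 * bcoord u ord0)) p) => //.
    by rewrite {1}pE cone_htpy_nil2 // -pE m1 mulr1.
have c2 : cls a (end_path (set_val x) t) =
    radius q phic a (std_simplex_map (lift ord0) t) -
    radius q phic a (vertex R (lift ord0 ord0)).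
  rewrite (path_class_in_cell qD q_bd phic a (gam := fun u : simplex 1 =>
    std_simplex_map (lift ord0) (line (bcoord u ord0) t (vertex R ord0)))).
  - rewrite !bcoord_vertex /= line0 line1 vertex_map //.
  - move=> u; apply: (@continuous_comp _ _ _ (fun u : simplex 1 =>
      line (bcoord u ord0) t (vertex R ord0)) (std_simplex_map (lift ord0))).
      by apply: line_continuous; [exact: bcoord_continuous| |]; exact: cst_continuous.
    exact: std_simplex_map_continuous.
  - move=> u; rewrite /= /phi -cellf_face // consf_lift //.
have c3 : cls a (edge g (set_val x ord0)) =
    radius q phic a (vertex R (lift ord0 ord0)) - radius q phic a (vertex R ord0).
  pose f : 'I_2 -> 'I_n.+2 := widen_ord (isT : (2 <= n.+2)%N).
  have f0 : f ord0 = ord0 by exact: ord_inj.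
  have f1 : f (lift ord0 ord0) = lift ord0 ord0 by exact: ord_inj.
  rewrite (path_class_in_cell qD q_bd phic a (gam := std_simplex_map f)).
  - by rewrite !vertex_map f0 f1.
  - exact: std_simplex_map_continuous.
  - move=> u; rewrite /= /phi -cellf_initial //.
    congr cellf; apply/funext => i; rewrite /ltup /=.
    case: (unliftP ord0 i) => [j ->|->].
      by rewrite ord1 f1 consfS.
    by rewrite f0 consf0.
rewrite c1 -(edgeD a 1%g g (set_val x ord0)) c2 c3.
by rewrite !addrA [RHS](ACl ((1*6)*(2*5)*(4*3))) /= !subrr !add0r.
Qed.

(** P p is the class of the standard path to p. Within one open star the star contraction shows that
    [rho] and P change by the same amount, the correction depending on g cancelling between
    endpoints; short steps along s add up to the claim. *)
Lemma path_class_endpoints : exists E1 E2 : Y -> singular_simplex R Y 1,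
  forall a (s : singular_simplex R Y 1),
  cls a s = (cls a (E1 (s (v1 R))) + cls a (E2 (s (v1 R)))) -
            (cls a (E1 (s (v0 R))) + cls a (E2 (s (v0 R)))).
Proof.
have [E1 [E2 EP]] := cone_htpy_class; exists E1, E2 => a s.
pose P p := cls a (E1 p) + cls a (E2 p).
rewrite -/(P (s (v1 R))) -/(P (s (v0 R))).
have sc : continuous s by exact: cts_fun.
pose rho := radius q sc a.
(* The integer K makes min(1, K * lam g) equal to 1 on a whole ball, so that the star contraction is
   complete there. *)
have [e e0 eW] : exists2 e : R, 0 < e & forall t, exists gK : G * nat, forall t',
    (forall j, `|bcoord t' j - bcoord t j| < e) -> 1 < gK.2%:R * lam gK.1 (s t').
  apply: (@simplex_lebesgue R 1 (G * nat)%type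
    (fun gK => [set t | 1 < gK.2%:R * lam gK.1 (s t)])) => [[g K]|t].
    apply: (@open_comp _ _ (fun t => K%:R * lam g (s t)) [set x | 1 < x]);
      last exact: open_gt.
    move=> t _; apply: fun_continuousM; first exact: fun_continuous_cst.
    move=> u; apply: (@continuous_comp _ _ _ s (lam g)); first exact: sc.
    exact: lam_continuous.
  have [g g0] := lam_cover (s t).
  exists (g, Num.bound (1 / lam g (s t))) => /=.
  rewrite -ltr_pdivrMr //; apply: archi_boundP.
  by rewrite ltW // divr_gt0.
have near (b c : simplex 1) : (forall j, `|bcoord c j - bcoord b j| < e) ->
    rho c - P (s c) = rho b - P (s b).
  move=> bc; have [[g K] /= gK] := eW b.
  pose gam (u : simplex 1) := line (bcoord u (lift ord0 ord0)) b c.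
  have gc : continuous gam.
    by apply: line_continuous; [exact: bcoord_continuous| |]; exact: cst_continuous.
  have g1 : gam (v1 R) = c by rewrite /gam bcoord_vertex eqxx line1.
  have g0 : gam (v0 R) = b by rewrite /gam bcoord_vertex /= line0.
  pose m (p : Y) := Order.min 1 (K%:R * lam g p).
  have mc : continuous m.
    apply: fun_continuous_min; first exact: fun_continuous_cst.
    apply: fun_continuousM; first exact: fun_continuous_cst.
    exact: lam_continuous.
  have m0 n (x : E3_simplex G n) (t : simplex n) :
      ~ affinely_nil2 (consf g (set_val x)) -> m (cell_point x t) = 0.
    move=> nx; rewrite /m.
    have -> : lam g (cell_point x t) = 0.
      apply/eqP; rewrite eq_le lam_ge0 andbT leNgt; apply/negP => /lam_gt0_mem gx.
      apply: nx; apply/affinely_nil2P; apply: (@nil2_sub _ _ (codom (set_val x))).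
        move=> _ /codomP[i ->]; case: (unliftP ord0 i) => [j ->|->].
          by rewrite consfS codom_f.
        by rewrite consf0.
      by apply/affinely_nil2P; exact: (set_valP x).
    by rewrite mulr0 min_r.
  have m1 u : m (s (gam u)) = 1.
    rewrite /m min_l // ltW //; apply: gK => j; rewrite bcoord_line.
    have -> : forall k, (1 - k) * bcoord b j + k * bcoord c j - bcoord b j =
        k * (bcoord c j - bcoord b j) by move=> k; ring.
    apply: le_lt_trans (bc j); rewrite normrM ler_piMl // ger0_norm ?clip_ge0 //.
    exact: clip_le1.
  have sgc : continuous (s \o gam).
    by move=> u; apply: continuous_comp; [exact: gc|exact: sc].
  pose sg : singular_simplex R Y 1 := mkcts sgc.
  have p1 : cls a sg = rho c - rho b.
    by rewrite (path_class_in_cell qD q_bd sc a gc) // g1 g0.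
  have p2 : cls a sg = P (s c) - P (s b).
    rewrite (cone_path_class qD q_bd (cone_htpy_continuous mc m0) a (s := sg)).
    - have -> : sg (v1 R) = s c by rewrite -[LHS]/(s (gam (v1 R))) g1.
      have -> : sg (v0 R) = s b by rewrite -[LHS]/(s (gam (v0 R))) g0.
      rewrite !EP; first by rewrite opprB addrA subrK.
        by rewrite -g0 m1.
      by rewrite -g1 m1.
    - by move=> t t'; rewrite !cone_htpy1 //; exact: m1.
    - by move=> t; rewrite /= cone_htpy0.
  by apply: subr_swap; rewrite -p1.
(* K+1 equal steps from [v0] to [v1], each shorter than the Lebesgue number e. *)
have [K KP] : exists K : nat, K.+1%:R^-1 < e.
  exists (Num.bound e^-1); rewrite -[ltRHS]invrK ltf_pV2 ?posrE ?invr_gt0 ?ltr0n //.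
  apply: lt_trans (archi_boundP _) _; first by rewrite invr_ge0 ltW.
  by rewrite ltr_nat.
pose z k := line (k%:R / K.+1%:R) (v0 R) (v1 R).
have zk k : (k <= K.+1)%N -> rho (z k) - P (s (z k)) = rho (v0 R) - P (s (v0 R)).
  elim: k => [_|k IH kK]; first by rewrite /z mul0r line0.
  rewrite -IH ?(ltnW kK) //; apply: near => j; rewrite !bcoord_line.
  have clipE i : (i <= K.+1)%N -> clip (i%:R / K.+1%:R : R) = i%:R / K.+1%:R.
    move=> iK; rewrite /clip min_r ?max_r ?divr_ge0 ?ler0n //.
    by rewrite ler_pdivrMr ?ltr0n // mul1r ler_nat.
  rewrite !clipE ?(ltnW kK) // -natr1.
  have -> : forall c x y : R, (1 - (k%:R + 1) * c) * x + (k%:R + 1) * c * y -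
      ((1 - k%:R * c) * x + k%:R * c * y) = c * (y - x) by move=> c x y; ring.
  apply: le_lt_trans KP; rewrite normrM ger0_norm ?invr_ge0 ?ler0n //.
  rewrite ler_piMr ?invr_ge0 ?ler0n // ler_norml.
  have := bcoord_ge0 (v0 R) j; have := bcoord_ge0 (v1 R) j.
  by have := bcoord_le1 (v0 R) j; have := bcoord_le1 (v1 R) j; lra.
have := zk K.+1 (leqnn _); rewrite /z divff ?pnatr_eq0 // line1 => E.
rewrite (path_class_in_cell qD q_bd sc a (gam := id)) //.
  exact: subr_swap E.
by move=> ?; exact: cvg_id.
Qed.

End EdgePaths.

(** Since path classes depend only on endpoints, the class of a 1-chain is an additive function of
    its boundary and vanishes on cycles. *)
Lemma full_skeleton_homology1 (R : realType) (G : groupType) (A : zmodType) :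
  (forall x y z : G, nil2 [:: x; y; z]) -> singular_homology_eq0 R (E3 R G) A 1.
Proof.
move=> full c /= cz; have [Q [q [qD qP]]] := @boundary_quotient R (E3 R G) A 1.
apply/qP.
have q_bd d : q (singular_bd d) = 0 by apply/qP; exists d.
have [E1 [E2 EP]] := path_class_endpoints qD q_bd full.
pose psi (s : singular_simplex R (E3 R G) 1) x := path_class q x s.
have psiD : additive_at psi by move=> s x y; exact: path_classD.
pose phi (s : singular_simplex R (E3 R G) 0) x :=
  psi (E1 (s (vertex R ord0))) x + psi (E2 (s (vertex R ord0))) x.
have phiD : additive_at phi.
  by move=> s x y; rewrite /phi !psiD addrACA.
have q0 : q 0 = 0 by apply: (addrI (q 0)); rewrite -qD !addr0.
transitivity (lin psi c).
  by rewrite [in LHS](monalgE c) (big_morph q qD q0).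
transitivity (lin phi (singular_bd c)); last by rewrite cz lin0.
rewrite lin_singular_bd //; apply: eq_bigr => s _.
rewrite big_ord_recl big_ord1 expr0 expr1 mulr1z mulrN1z (lin_atN phiD).
by rewrite path_face0 path_face1 /psi EP.
Qed.

(** * The homological criteria for the group *)

Section Consequences.
Variables (R : realType) (G : groupType) (e : nat).
Hypothesis class3 : forall x y z : G, group_center G [~ [~ x, y], z]%g.
Hypothesis exponent : forall x, lower_central 3 [set: G] x -> (x ^+ e = 1)%g.

Lemma two_Engel_triple : two_Engel G <-> forall x y : G, triple x y y = 0.
Proof.
split=> eG x y; first by rewrite /triple eG to_center1.
exact/(triple_eq0 class3)/eG.
Qed.

Lemma two_Engel_nil2 (x y z : G) : two_Engel G -> nil2 [:: x; y; z].
Proof.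
move=> /two_Engel_triple eG; pose a := (x^-1 * y)%g; pose b := (x^-1 * z)%g.
have -> : [:: x; y; z] = [:: x; x * a; x * b]%g.
  by rewrite /a /b !mulgA mulgV !mul1g.
by apply: nil2_triple; rewrite // triple_antisym // eG oppr0.
Qed.

Lemma homology1_two_Engel :
  (forall H : set G, is_subgroup H -> nilpotent_class_le 2 H ->
    power_subgroup 3 (commutator_subgroup H H) `<=` group_center G) ->
  singular_homology_eq0 R (E3 R G) (Zmod e) 1 -> two_Engel G.
Proof.
move=> cube H1; apply/two_Engel_triple => x y; apply: engel_of_cochain => // {}x {}y.
have : cobd (@engel_cochain G) [:: 1%g; x; y] = 0.
  apply: (homology_detect (R := R) (e := e) (n := 0)) => //.
  - by move=> l; have [] := cochain_torsion class3 l exponent.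
  - by move=> l sl nl; exact: engel_cochain_cocycle.
  (* The faces of (1,x,y) are pairs, and any pair is a simplex. *)
  - by move=> [|[|[|]]] // _; exact: nil2_pair.
by rewrite !cobd_cons !cobd_nil /= !triple1l ?(subr0, addr0).
Qed.

Lemma homology2_class2 : two_Engel G ->
  singular_homology_eq0 R (E3 R G) (Zmod e) 2 -> nilpotent_class_le 2 [set: G].
Proof.
move=> eG H2; apply/(nilpotent2_triple class3) => // x y z _ _ _.
have : cobd (@triple_cochain G) [:: 1%g; x; y; z] = 0.
  apply: (homology_detect (R := R) (e := e) (n := 1)) => //.
  - by move=> l; have [] := cochain_torsion class3 l exponent.
  - by move=> l sl nl; apply: triple_cochain_cocycle => //; exact/two_Engel_triple.
  (* The faces of (1,x,y,z) are triples, and the 2-Engel law makes every triple a simplex. *)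
  - by move=> [|[|[|[|]]]] // _; exact: two_Engel_nil2.
by rewrite !cobd_cons !cobd_nil /= !triple1l !subr0.
Qed.

End Consequences.

Local Close Scope ring_scope.
Local Close Scope quotient_scope.

Theorem theorem3p4 (R : realType) (G : groupType) (e : nat) :
  nilpotent_class_le 3 [set: G] ->
  has_exponent (lower_central 3 [set: G]) e ->
  (forall H : set G, is_subgroup H -> nilpotent_class_le 2 H ->
    power_subgroup 3 (commutator_subgroup H H) `<=` group_center G) ->
  (singular_homology_eq0 R (E3 R G) (Zmod e) 1 <-> two_Engel G) /\
  ((singular_homology_eq0 R (E3 R G) (Zmod e) 1 /\
    singular_homology_eq0 R (E3 R G) (Zmod e) 2)
   <-> nilpotent_class_le 2 [set: G]).
Proof.
move=> /nilpotent3_central class3 he cube.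
(* For e = 0 the power x^0 is 1, so the case without exponent needs no separate treatment. *)
have exponent x : lower_central 3 [set: G] x -> (x ^+ e = 1)%g.
  by case: he => [[[_ + _]]|[-> _]]; [apply|rewrite expg0].
split; [split=> [|eG]|split=> [[H1 H2]|nG]].
- exact: homology1_two_Engel.
- by apply: full_skeleton_homology1 => x y z; exact: two_Engel_nil2.
- apply: homology2_class2 H2 => //.
  exact: homology1_two_Engel H1.
- by split; exact: nilpotent2_homology0.
Qed.
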